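(* Let $k$, $G$, $V$ and $S=S(V)$ be as in the context. Consider two cohomology classes $\alpha',\beta'\in \mathrm{HH}^2(S\# G)$ represented by cochains $\alpha,\beta\in (H^2)^G$ of polynomial degree at most $1$. Then the Gerstenhaber bracket in $\mathrm{HH}^3(S\# G)$ of $\alpha'$ and $\beta'$ is represented by the cochain bracket $[\alpha,\beta]$.
   Context: Setting: $k$ is a field of characteristic not $2$; $G$ is a finite group acting linearly (not necessarily faithfully) on a finite-dimensional $k$-vector space $V$; $|G|$ is invertible in $k$; and $k$ contains all eigenvalues of the actions of elements of $G$ on $V$. Write ${}^g v$ for the action, extended to $S=S(V)$ by automorphisms. $S\# G=S\otimes kG$ with multiplication $(s_1 g)(s_2 h)=s_1\,({}^g s_2)\,gh$. Cochains. $C^p=\bigoplus_{g\in G}C^p_g$ with $C^p_g=S g\otimes\bigwedge^p V^*$, identified with $\mathrm{Hom}_k(\bigwedge^pV,Sg)$; write $\alpha=\sum_g\alpha_g\,g$ with $\alpha_g:\bigwedge^pV\to S$. This is $\mathrm{Hom}_{S^e}(K_p(S),S\# G)$, where $S^e=S\otimes S^{op}$ and $K_p(S)=S^e\otimes\bigwedge^pV$ is the Koszul resolution of $S$ with differential $d_p(1\otimes1\otimes v_1\wedge\cdots\wedge v_p)=\sum_i(-1)^{i+1}(v_i\otimes1-1\otimes v_i)\otimes(v_1\wedge\cdots\wedge\hat v_i\wedge\cdots\wedge v_p)$. Thus $(d^*\alpha)(v_1\wedge\cdots\wedge v_{p+1})=\sum_i(-1)^{i+1}\big(v_i\,\alpha(\cdots\hat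 v_i\cdots)-\alpha(\cdots\hat v_i\cdots)\,v_i\big)$ in $S\# G$. $G$ acts on $C^p$ by $({}^h\alpha)(v_1\wedge\cdots\wedge v_p)={}^h\big(\alpha({}^{h^{-1}}v_1\wedge\cdots\wedge{}^{h^{-1}}v_p)\big)$ with ${}^h(sg)=({}^hs)\,hgh^{-1}$; a superscript $G$ denotes invariants. A cochain is constant (resp. linear) if all its polynomial factors in $S$ are homogeneous of degree $0$ (resp. $1$), and has polynomial degree at most $1$ if it is a sum of a constant and a linear cochain. Representatives. $V^g$ is the $g$-fixed subspace and $(V^g)^\perp$ its $g$-stable complement (the sum of the eigenspaces of $g$ with eigenvalue $\ne1$). Set $$H^p=\bigoplus_{g\in G}S(V^g)\,g\otimes\textstyle\bigwedge^{p-\mathrm{codim}V^g}(V^g)^*\otimes\bigwedge^{\mathrm{codim}V^g}((V^g)^\perp)^*\subset C^p,$$ using $V=V^g\oplus(V^g)^\perp$ and the convention that negative exterior powers are zero. All elements of $H^p$ are cocycles, and $H^\bullet\cong \mathrm{HH}^\bullet(S,S\# G)=\mathrm{Ext}^\bullet_{S^e}(S,S\# G)$, $(H^\bullet)^G\cong \mathrm{HH}^\bullet(S,S\# G)^G\cong \mathrm{HH}^\bullet(S\# G)$. A class in $\mathrm{HH}^p(S\# G)$ is represented by a cocycle $\gamma\in C^p$ if its image under the isomorphism $\mathrm{HH}^p(S\# G)\cong \mathrm{HH}^p(S,S\# G)^G$ (restriction of cochains on the bar resolution from $S\# G$ to $S$) is the class of $\gamma$; here cochains on the bar resolution of $S$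 are carried to $C^\bullet$ by composing with the chain map $\phi_p(1\otimes1\otimes v_1\wedge\cdots\wedge v_p)=\sum_{\sigma\in\mathrm{Sym}_p}\mathrm{sgn}(\sigma)\,1\otimes v_{\sigma(1)}\otimes\cdots\otimes v_{\sigma(p)}\otimes1$. Gerstenhaber bracket. For a $k$-algebra $R$ and Hochschild $2$-cochains $\mu,\nu\in\mathrm{Hom}_k(R^{\otimes2},R)$, put $(\mu\circ\nu)(r_1\otimes r_2\otimes r_3)=\mu(\nu(r_1\otimes r_2)\otimes r_3)-\mu(r_1\otimes\nu(r_2\otimes r_3))$ and $[\mu,\nu]=\mu\circ\nu+\nu\circ\mu$; this induces the Gerstenhaber bracket $\mathrm{HH}^2(R)\times\mathrm{HH}^2(R)\to\mathrm{HH}^3(R)$. Cochain bracket. The cochain bracket $[\cdot,\cdot]$ is the symmetric bilinear map from pairs of $2$-cochains of polynomial degree at most $1$ to $3$-cochains of polynomial degree at most $1$ determined as follows ($\mathrm{Alt}_3$ is the cyclic group of order $3$ in $\mathrm{Sym}_3$). For $\alpha,\beta$ linear, $$[\alpha,\beta](v_1,v_2,v_3)=\sum_{g,h\in G,\ \sigma\in\mathrm{Alt}_3}\Big[\alpha_{gh^{-1}}\big(\beta_h(v_{\sigma(1)}\wedge v_{\sigma(2)})\wedge v_{\sigma(3)}\big)+\beta_{gh^{-1}}\big(\alpha_h(v_{\sigma(1)}\wedge v_{\sigma(2)})\wedge v_{\sigma(3)}\big)\Big]g;$$ for $\alpha$ constant and $\beta$ linear, $$[\alpha,\beta](v_1,v_2,v_3)=\sum_{g,h\in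 G,\ \sigma\in\mathrm{Alt}_3}\alpha_{gh^{-1}}\big(\beta_h(v_{\sigma(1)}\wedge v_{\sigma(2)})\wedge v_{\sigma(3)}\big)\,g;$$ and $[\alpha,\beta]=0$ for $\alpha,\beta$ both constant. *)

(* Defs.v *)
From HB Require Import structures.
From mathcomp Require Import all_boot all_order all_algebra all_fingroup.
From mathcomp Require Import all_solvable.
From mathcomp Require Import mpoly boolp.

Set Implicit Arguments.
Unset Strict Implicit.
Unset Printing Implicit Defensive.

Import GRing.Theory.
Local Open Scope ring_scope.
Local Open Scope quotient_scope.

Definition multilinear (k : fieldType) (U W : lmodType k) (p : nat)
    (f : ('I_p -> U) -> W) : Prop :=
  forall (i : 'I_p) (u : 'I_p -> U) (a : k) (x y : U),
    f [eta u with i |-> a *: x + y] =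
    a *: f [eta u with i |-> x] + f [eta u with i |-> y].

Section HochschildCochains.
Variables (k : fieldType) (A : algType k).

(* A p-cochain, i.e. an element of Hom_k(A^{(x)p}, A), is a multilinear map in
   p arguments indexed by 'I_p.  [lift i] is the increasing map skipping i. *)
Definition hdiff (p : nat) (f : ('I_p -> A) -> A) (r : 'I_p.+1 -> A) : A :=
  r ord0 * f (fun j => r (lift ord0 j))
  + \sum_(i < p) (-1) ^+ i.+1 *
      f (fun j => if (j < i)%N then r (lift ord_max j)
                  else if j == i then r (lift ord_max j) * r (lift ord0 j)
                  else r (lift ord0 j))
  + (-1) ^+ p.+1 * (f (fun j => r (lift ord_max j)) * r ord_max).

Record hcocycle (p : nat) := HCocycle {
  hcocycle_fun :> ('I_p -> A) -> A;
  hcocycle_multilinear : multilinear hcocycle_fun;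
  hcocycle_closed : forall r, hdiff hcocycle_fun r = 0 }.

Definition hcoboundary (p : nat) : (('I_p -> A) -> A) -> Prop :=
  match p return (('I_p -> A) -> A) -> Prop with
  | 0 => fun f => forall r, f r = 0
  | q.+1 => fun f => exists2 g : ('I_q -> A) -> A,
      multilinear g & forall r, f r = hdiff g r
  end.

Definition hcohomologous (p : nat) (f g : hcocycle p) : bool :=
  `[< hcoboundary (fun r => f r - g r) >].

Lemma multilinearB (U W : lmodType k) p (f g : ('I_p -> U) -> W) :
  multilinear f -> multilinear g -> multilinear (fun r => f r - g r).
Proof.
by move=> lf lg i u a x y; rewrite lf lg scalerBr opprD addrACA.
Qed.

Lemma multilinearD (U W : lmodType k) p (f g : ('I_p -> U) -> W) :
  multilinear f -> multilinear g -> multilinear (fun r => f r + g r).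
Proof.
by move=> lf lg i u a x y; rewrite lf lg scalerDr addrACA.
Qed.

Lemma multilinear0 (U W : lmodType k) p :
  multilinear (fun _ : 'I_p -> U => 0 : W).
Proof. by move=> i u a x y; rewrite scaler0 addr0. Qed.

Lemma hdiffB p (f g : ('I_p -> A) -> A) r :
  hdiff (fun r => f r - g r) r = hdiff f r - hdiff g r.
Proof.
rewrite /hdiff (eq_bigr _ (fun i _ => mulrBr _ _ _)) sumrB /=.
rewrite mulrBr mulrBl mulrBr !opprD [RHS]addrACA; congr (_ + _).
by rewrite addrACA.
Qed.

Lemma hcoboundaryB p (f g : ('I_p -> A) -> A) :
  hcoboundary f -> hcoboundary g -> hcoboundary (fun r => f r - g r).
Proof.
case: p f g => [f g f0 g0 r|p f g [f' lf Df] [g' lg Dg]] /=.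
  by rewrite f0 g0 subrr.
by exists (fun r => f' r - g' r);
  [exact: multilinearB | move=> r; rewrite Df Dg hdiffB].
Qed.

Lemma hcohomologous_refl p : reflexive (@hcohomologous p).
Proof.
move=> f; apply/asboolP.
have -> : (fun r => f r - f r) = (fun _ => 0).
  by apply/funext => r; rewrite subrr.
case: p f => [|p] f //=; exists (fun _ => 0); first exact: multilinear0.
move=> r; have := hdiffB (fun _ => 0) (fun _ => 0) r.
by rewrite !subrr.
Qed.

Lemma hcohomologous_sym p : ssrbool.symmetric (@hcohomologous p).
Proof.
suff H (f g : hcocycle p) : hcohomologous f g -> hcohomologous g f.
  by move=> f g; apply/idP/idP; apply: H.
have /asboolP g0 := hcohomologous_refl g.
move=> /asboolP fg; apply/asboolP; have := hcoboundaryB g0 fg.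
by congr hcoboundary; apply/funext => r; rewrite opprB addrA subrK.
Qed.

Lemma hcohomologous_trans p : transitive (@hcohomologous p).
Proof.
move=> g f h /asboolP fg; rewrite hcohomologous_sym => /asboolP hg.
apply/asboolP; have := hcoboundaryB fg hg.
by congr hcoboundary; apply/funext => r; rewrite opprB addrA subrK.
Qed.

HB.instance Definition _ p := gen_eqMixin (hcocycle p).
HB.instance Definition _ p := gen_choiceMixin (hcocycle p).

Canonical hcohomologous_equiv p := EquivRel (@hcohomologous p)
  (@hcohomologous_refl p) (@hcohomologous_sym p) (@hcohomologous_trans p).

Definition HH (p : nat) := {eq_quot @hcohomologous p}.

HB.instance Definition _ p := Choice.on (HH p).
HB.instance Definition _ p := EqQuotient.on (HH p).


(* Closes 0 + x_1 + ... + x_n = 0 when the x_i cancel in pairs. *)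
Local Ltac zcancel :=
  rewrite ?(opprD, opprK, addrA);
  repeat (match goal with
    |- context [ - ?x ] =>
        do ?[rewrite (addrAC _ x)]; do ?[rewrite (addrAC _ (- x))];
        first [rewrite addrK | rewrite subrK]
    end).

Definition pair2 (T : Type) (x y : T) : 'I_2 -> T := tnth [tuple x; y].

Definition hcirc (m n : ('I_2 -> A) -> A) (r : 'I_3 -> A) : A :=
  m (pair2 (n (pair2 (r 0) (r 1))) (r 2))
  - m (pair2 (r 0) (n (pair2 (r 1) (r 2)))).

Definition gbracket_fun (m n : ('I_2 -> A) -> A) (r : 'I_3 -> A) : A :=
  hcirc m n r + hcirc n m r.

Lemma hdiff1E (f : ('I_1 -> A) -> A) a b : hdiff f (pair2 a b) =
  a * f (fun=> b) - f (fun=> a * b) + f (fun=> a) * b.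
Proof.
rewrite /hdiff big_ord1 /= expr1 mulN1r sqrrN expr1n mul1r.
congr (_ * f _ - f _ + f _ * _); apply/funext => -[[|//] i];
  by rewrite /pair2 !(tnth_nth 0).
Qed.

Lemma hdiff2E (f : ('I_2 -> A) -> A) a b c : hdiff f (tnth [tuple a; b; c]) =
  a * f (pair2 b c) - f (pair2 (a * b) c) + f (pair2 a (b * c))
  - f (pair2 a b) * c.
Proof.
rewrite /hdiff !big_ord_recl big_ord0 addr0 /=.
rewrite !exprS !expr0 ?mulN1r ?opprK ?mulN1r ?opprK ?mul1r ?addrA.
congr (_ * f _ - f _ + f _ - f _ * _); apply/funext => -[[|[|//]] i];
  by rewrite /pair2 !(tnth_nth 0).
Qed.

Lemma hdiff3E (f : ('I_3 -> A) -> A) (r : 'I_4 -> A) :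
  let: (a, b, c, d) := (r 0, r 1, r 2, r 3) in hdiff f r =
  a * f (tnth [tuple b; c; d]) - f (tnth [tuple a * b; c; d])
  + f (tnth [tuple a; b * c; d]) - f (tnth [tuple a; b; c * d])
  + f (tnth [tuple a; b; c]) * d.
Proof.
rewrite /hdiff !big_ord_recl big_ord0 addr0 /=.
rewrite !exprS !expr0 ?(mulN1r, opprK, mul1r) ?addrA.
congr (_ * f _ - f _ + f _ - f _ + f _ * _); try (apply/funext => -[[|[|[|//]]] i]);
  rewrite ?(tnth_nth 0) /=; do ?congr (_ * _); congr r; exact: val_inj.
Qed.

Lemma tuple3E (T : Type) (r : 'I_3 -> T) : r = tnth [tuple r 0; r 1; r 2].
Proof.
by apply/funext => -[[|[|[|//]]] i]; rewrite ?(tnth_nth (r 0)) /=;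
  congr r; exact: val_inj.
Qed.

Lemma pair2E (T : Type) (r : 'I_2 -> T) : r = pair2 (r 0) (r 1).
Proof.
by apply/funext => -[[|[|//]] i]; rewrite /pair2 ?(tnth_nth (r 0)) /=;
  congr r; exact: val_inj.
Qed.

Section Bilinear.
Variables (U W : lmodType k) (f : ('I_2 -> U) -> W) (lf : multilinear f).

Lemma pair2_linl z : linear (fun x => f (pair2 x z)).
Proof.
have E w x : ([eta pair2 w z with 0 |-> x] : 'I_2 -> U) = pair2 x z.
  by apply/funext => -[[|[|//]] i].
by move=> a x y; have := lf 0 (pair2 x z) a x y; rewrite !E.
Qed.

Lemma pair2_linr z : linear (fun x => f (pair2 z x)).
Proof.
have E w x : ([eta pair2 z w with 1 |-> x] : 'I_2 -> U) = pair2 z x.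
  by apply/funext => -[[|[|//]] i].
by move=> a x y; have := lf 1 (pair2 z x) a x y; rewrite !E.
Qed.

Lemma linearDB (g : U -> W) : linear g ->
  {morph g : x y / x + y} * {morph g : x y / x - y}.
Proof.
move=> lg; have gB : {morph g : x y / x - y}.
  by move=> x y; rewrite addrC -scaleN1r lg scaleN1r addrC.
split=> // x y; have g0 : g 0 = 0 by rewrite -(subrr 0) gB subrr.
by rewrite -{1}(opprK y) gB -(sub0r y) gB g0 sub0r opprK.
Qed.

Lemma pair2Dl x y z : f (pair2 (x + y) z) = f (pair2 x z) + f (pair2 y z).
Proof. by have [/(_ x y)] := linearDB (pair2_linl z). Qed.

Lemma pair2Bl x y z : f (pair2 (x - y) z) = f (pair2 x z) - f (pair2 y z).
Proof. by have [_ /(_ x y)] := linearDB (pair2_linl z). Qed.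

Lemma pair2Dr x y z : f (pair2 z (x + y)) = f (pair2 z x) + f (pair2 z y).
Proof. by have [/(_ x y)] := linearDB (pair2_linr z). Qed.

Lemma pair2Br x y z : f (pair2 z (x - y)) = f (pair2 z x) - f (pair2 z y).
Proof. by have [_ /(_ x y)] := linearDB (pair2_linr z). Qed.

End Bilinear.

Lemma multilinear_hcirc m n :
  multilinear m -> multilinear n -> multilinear (hcirc m n).
Proof.
move=> lm ln.
have Em := (pair2_linl lm, pair2_linr lm).
have En := (pair2_linl ln, pair2_linr ln).
move=> [[|[|[|//]]] i] u a x y; rewrite /hcirc /= ?Em ?En ?Em scalerBr;
 by rewrite ?opprD addrACA.
Qed.

Lemma hcirc_tuple m n a b c : hcirc m n (tnth [tuple a; b; c]) =
  m (pair2 (n (pair2 a b)) c) - m (pair2 a (n (pair2 b c))).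
Proof. by []. Qed.

Lemma hdiff_hcirc (m n : hcocycle 2) (r : 'I_4 -> A) :
  let: (a, b, c, d) := (r 0, r 1, r 2, r 3) in
  hdiff (hcirc m n) r =
  n (pair2 a b) * m (pair2 c d) - m (pair2 a b) * n (pair2 c d).
Proof.
rewrite hdiff3E.
move: (r 0) (r 1) (r 2) (r 3) => a b c d; rewrite !hcirc_tuple.
have Z (f : hcocycle 2) x y z : x * f (pair2 y z) - f (pair2 (x * y) z)
    + f (pair2 x (y * z)) - f (pair2 x y) * z = 0.
  by rewrite -hdiff2E; exact: hcocycle_closed.
have M0 x : m (pair2 0 x) = 0.
  by rewrite -{1}(subrr 0) (pair2Bl (hcocycle_multilinear m)) subrr.
have M1 x : m (pair2 x 0) = 0.
  by rewrite -{1}(subrr 0) (pair2Br (hcocycle_multilinear m)) subrr.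
have := congr2 +%R (M0 d) (M1 a); rewrite -{1}(Z n a b c) -{1}(Z n b c d).
rewrite !(pair2Bl (hcocycle_multilinear m), pair2Dl (hcocycle_multilinear m)).
rewrite !(pair2Br (hcocycle_multilinear m), pair2Dr (hcocycle_multilinear m)).
rewrite addr0 => E12.
have E4 := Z m a (n (pair2 b c)) d.
have := congr2 (fun x y => x - y) (congr2 (fun x y => x - y) E4 (Z m (n (pair2 a b)) c d))
   (Z m a b (n (pair2 c d))).
rewrite !subr0 => E345.
apply/eqP; rewrite -subr_eq0; apply/eqP.
rewrite -[RHS](addr0 0) -{1}E12 -E345; apply/eqP; rewrite -subr_eq0; apply/eqP.
rewrite !mulrBr !mulrBl -[LHS]add0r.
by zcancel.
Qed.

Lemma hdiffD p (f g : ('I_p -> A) -> A) r :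
  hdiff (fun r => f r + g r) r = hdiff f r + hdiff g r.
Proof.
rewrite /hdiff (eq_bigr _ (fun i _ => mulrDr _ _ _)) big_split /=.
rewrite mulrDr mulrDl mulrDr [RHS]addrACA; congr (_ + _).
by rewrite addrACA.
Qed.

Lemma gbracket_multilinear (m n : hcocycle 2) : multilinear (gbracket_fun m n).
Proof.
by apply: multilinearD; apply: multilinear_hcirc; exact: hcocycle_multilinear.
Qed.

Lemma gbracket_closed (m n : hcocycle 2) r : hdiff (gbracket_fun m n) r = 0.
Proof. by rewrite /gbracket_fun hdiffD !hdiff_hcirc addrA subrK subrr. Qed.

Definition gbracket_cocycle (m n : hcocycle 2) : hcocycle 3 :=
  HCocycle (gbracket_multilinear m n) (gbracket_closed m n).

(* The bracket on classes is computed on chosen representatives;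
   [gbracket_pi] says that it does not depend on the choice. *)
Definition gbracket (a b : HH 2) : HH 3 :=
  \pi_(HH 3) 
    (gbracket_cocycle (generic_quotient.repr a) (generic_quotient.repr b)).

Lemma gbracket_funC m n : gbracket_fun m n = gbracket_fun n m.
Proof. by apply/funext => r; rewrite /gbracket_fun addrC. Qed.

Lemma gbracket_hdiff (g : ('I_1 -> A) -> A) (n : hcocycle 2) : multilinear g ->
  hcoboundary (gbracket_fun (hdiff g) n).
Proof.
move=> lg; have ln := hcocycle_multilinear n.
pose L x := g (fun=> x).
have linL : linear L.
  have E x z : ([eta (fun=> z) with 0 |-> x] : 'I_1 -> A) = (fun=> x).
    by apply/funext => j; rewrite /= ord1.
  by move=> a x y; have := lg 0 (fun=> 0) a x y; rewrite !E.
have LB : {morph L : x y / x - y} by have [] := linearDB linL.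
have LD : {morph L : x y / x + y} by have [] := linearDB linL.
pose G (r : 'I_2 -> A) := n (pair2 (L (r 0)) (r 1)) + n (pair2 (r 0) (L (r 1)))
  - L (n r).
exists G.
  apply: multilinearB => i u a x y; last by rewrite ln linL.
  case: i => [[|[|//]] i]; rewrite /= ?(linL, pair2_linl ln, pair2_linr ln);
    by rewrite scalerDr addrACA.
move=> r; rewrite (tuple3E r); move: (r 0) (r 1) (r 2) => a b c.
have GE x y : G (pair2 x y) =
  n (pair2 (L x) y) + n (pair2 x (L y)) - L (n (pair2 x y)) by [].
rewrite hdiff2E /gbracket_fun !hcirc_tuple !hdiff1E -!/(L _) !GE.
rewrite !(pair2Bl ln, pair2Br ln, pair2Dl ln, pair2Dr ln).
have Z x y z : x * n (pair2 y z) - n (pair2 (x * y) z)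
    + n (pair2 x (y * z)) - n (pair2 x y) * z = 0.
  by rewrite -hdiff2E; exact: hcocycle_closed.
have L0 : L 0 = 0 by rewrite -{1}(subrr 0) LB subrr.
move: L0; rewrite -{1}(Z a b c) !(LB, LD) => E1.
have := congr2 (fun x y => x - y) (congr2 (fun x y => x - y)
  (congr2 (fun x y => x - y) E1 (Z (L a) b c)) (Z a (L b) c)) (Z a b (L c)).
rewrite !subr0 => E.
apply/eqP; rewrite -subr_eq0; apply/eqP; rewrite -[RHS]E.
apply/eqP; rewrite -subr_eq0; apply/eqP.
rewrite !(mulrBr, mulrBl, mulrDr, mulrDl).
rewrite -[LHS]add0r.
by zcancel.
Qed.

Lemma gbracket_pi (m n : hcocycle 2) :
  gbracket (\pi_(HH 2) m) (\pi_(HH 2) n) = \pi_(HH 3) (gbracket_cocycle m n).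
Proof.
have H (m1 m2 n1 : hcocycle 2) : m1 = m2 %[mod HH 2] ->
    gbracket_cocycle m1 n1 = gbracket_cocycle m2 n1 %[mod HH 3].
  move=> /eqquotP /asboolP [g lg Dg]; apply/eqquotP/asboolP.
  have := gbracket_hdiff n1 lg; congr hcoboundary; apply/funext => r.
  have <- : (fun r => m1 r - m2 r) = hdiff g by apply/funext.
  rewrite /= /gbracket_fun /hcirc.
  rewrite !(pair2Bl (hcocycle_multilinear n1), pair2Br (hcocycle_multilinear n1)).
  apply/eqP; rewrite -subr_eq0; apply/eqP; rewrite -[LHS]add0r.
  by zcancel.
have C (m1 n1 : hcocycle 2) : gbracket_cocycle m1 n1 = gbracket_cocycle n1 m1 %[mod HH 3].
  have E := gbracket_funC m1 n1; apply/eqquotP/asboolP => /=.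
  have /asboolP := hcohomologous_refl (gbracket_cocycle m1 n1).
  by rewrite /= {2}E.
rewrite /gbracket (H _ m) ?reprK // C (H _ n) ?reprK // C.
Qed.

End HochschildCochains.

Record linear_rep (k : fieldType) (gT : finGroupType) (V : vectType k) :=
  LinearRep {
    rep_fun :> gT -> 'End(V);
    rep_one : rep_fun 1%g = \1%VF;
    rep_mul : forall g h : gT, rep_fun (g * h)%g = (rep_fun g \o rep_fun h)%VF }.

Section SymmetricAlgebra.
Variables (k : fieldType) (V : vectType k).

(* S(V) is the polynomial ring on the basis [vbasis {:V}] of V. *)
Definition Sym := {mpoly k[\dim {:V}]}.

HB.instance Definition _ := GRing.ComNzRing.on Sym.
HB.instance Definition _ := GRing.Lmodule.on Sym.

Definition sym_in (v : V) : Sym :=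
  \sum_(i < \dim {:V}) coord (vbasis {:V}) i v *: 'X_i.

(* Inverse of [sym_in] on linear polynomials; kills the other degrees. *)
Definition sym_lin (s : Sym) : V :=
  \sum_(i < \dim {:V}) s@_(U_(i)) *: (vbasis {:V})`_i.

(* The algebra endomorphism of S(V) induced by a linear endomorphism of V. *)
Definition sym_map (f : 'End(V)) (s : Sym) : Sym :=
  s \mPo [tuple sym_in (f (vbasis {:V})`_i) | i < \dim {:V}].

(* The image of S(W) in S(V), for a subspace W of V. *)
Definition sym_sub (W : {vspace V}) (s : Sym) : Prop :=
  exists q : {mpoly k[\dim W]},
    s = q \mPo [tuple sym_in (vbasis W)`_i | i < \dim W].

Lemma sym_in_linear : linear sym_in.
Proof.
move=> a u v; rewrite /sym_in scaler_sumr -big_split; apply: eq_bigr => i _ /=.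
by rewrite linearP scalerDl scalerA.
Qed.

HB.instance Definition _ := GRing.isSemilinear.Build k V Sym _ sym_in
  (GRing.semilinear_linear sym_in_linear).

HB.instance Definition _ f := GRing.LRMorphism.copy (sym_map f)
  (comp_mpoly [tuple sym_in (f (vbasis {:V})`_i) | i < \dim {:V}]).

Lemma sym_map_in f v : sym_map f (sym_in v) = sym_in (f v).
Proof.
rewrite {1}/sym_in linear_sum [in RHS](coord_vbasis (memvf v)).
rewrite !linear_sum; apply: eq_bigr => i _.
by rewrite !linearZ /= /sym_map comp_mpolyXU nth_mktuple.
Qed.

Lemma sym_inX (i : 'I_(\dim {:V})) : sym_in (vbasis {:V})`_i = 'X_i.
Proof.
rewrite /sym_in (bigD1 i) //= coord_free ?(basis_free (vbasisP _)) // eqxx.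
rewrite scale1r big1 ?addr0 // => j ji.
by rewrite coord_free ?(basis_free (vbasisP _)) // eq_sym (negPf ji) scale0r.
Qed.

Lemma sym_ind (f g : {lrmorphism Sym -> Sym}) :
  (forall v, f (sym_in v) = g (sym_in v)) -> f =1 g.
Proof.
move=> fg s; rewrite [s]mpolyE !linear_sum; apply: eq_bigr => m _.
rewrite !linearZ; congr (_ *: _); rewrite /= mpolyXE_id !rmorph_prod.
by apply: eq_bigr => i _; rewrite !rmorphXn /= -sym_inX fg.
Qed.

Lemma sym_map1 s : sym_map \1%VF s = s.
Proof.
by apply: (@sym_ind (sym_map \1%VF) idfun) => v /=; rewrite sym_map_in lfunE.
Qed.

Lemma sym_mapM f g s : sym_map (f \o g)%VF s = sym_map f (sym_map g s).
Proof.
apply: (@sym_ind (sym_map (f \o g)%VF) (sym_map f \o sym_map g)) => v /=.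
by rewrite !sym_map_in lfunE.
Qed.

End SymmetricAlgebra.

(* The element \sum_g s_g g of S # G is the function g |-> s_g; the type is
   tagged by rho, which enters the product. *)
Definition skew_galg (k : fieldType) (gT : finGroupType) (V : vectType k)
  (rho : linear_rep gT V) : Type := {ffun gT -> Sym V}.

Section SkewGroupAlgebra.
Variables (k : fieldType) (gT : finGroupType) (V : vectType k).
Variable rho : linear_rep gT V.
Local Notation skew_galg := (skew_galg rho).

HB.instance Definition _ := GRing.Lmodule.copy skew_galg {ffun gT -> Sym V}.

Definition skew_elt (s : Sym V) (g : gT) : skew_galg :=
  [ffun x => if x == g then s else 0].

Definition skew_one : skew_galg := skew_elt 1 1%g.

Definition skew_mul (a b : skew_galg) : skew_galg :=
  [ffun x => \sum_(g : gT) a g * sym_map (rho g) (b (g^-1 * x)%g)].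

Lemma skew_mul_elt s1 g s2 h : skew_mul (skew_elt s1 g) (skew_elt s2 h) =
  skew_elt (s1 * sym_map (rho g) s2) (g * h)%g.
Proof.
apply/ffunP => x; rewrite !ffunE (bigD1 g) //= big1 ?addr0; last first.
  by move=> y yg; rewrite ffunE (negPf yg) mul0r.
rewrite !ffunE eqxx -(inj_eq (mulgI g)) mulKVg; case: eqP => // _.
by rewrite linear0 mulr0.
Qed.

Lemma skew_mulA : associative skew_mul.
Proof.
move=> a b c; apply/ffunP => x; rewrite !ffunE.
under eq_bigr => g _ do rewrite ffunE linear_sum mulr_sumr.
under [RHS]eq_bigr => g _ do rewrite ffunE mulr_suml.
rewrite [RHS]exchange_big; apply: eq_bigr => g _ /=.
rewrite (reindex_inj (mulgI g^-1%g)); apply: eq_bigr => h _ /=.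
rewrite rmorphM mulrA /=; congr (_ * _ * _).
by rewrite -sym_mapM -rep_mul mulKVg invMg invgK mulgA mulgK.
Qed.

Lemma skew_mul1 : left_id skew_one skew_mul.
Proof.
move=> a; apply/ffunP => x; rewrite !ffunE (bigD1 1%g) //= big1 ?addr0.
  by rewrite ffunE eqxx mul1r rep_one sym_map1 invg1 mul1g.
by move=> g g1; rewrite ffunE (negPf g1) mul0r.
Qed.

Lemma skew_mulr1 : right_id skew_one skew_mul.
Proof.
move=> a; apply/ffunP => x; rewrite !ffunE (bigD1 x) //= big1 ?addr0.
  by rewrite ffunE mulVg eqxx rmorph1 mulr1.
by move=> g gx; rewrite ffunE -eq_mulVg1 (negPf gx) linear0 mulr0.
Qed.

Lemma skew_mulDl : left_distributive skew_mul +%R.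
Proof.
move=> a b c; apply/ffunP => x; rewrite !ffunE -big_split.
by apply: eq_bigr => g _; rewrite ffunE mulrDl.
Qed.

Lemma skew_mulDr : right_distributive skew_mul +%R.
Proof.
move=> a b c; apply/ffunP => x; rewrite !ffunE -big_split.
by apply: eq_bigr => g _; rewrite ffunE linearD mulrDr.
Qed.

Lemma skew_one_neq0 : skew_one != 0.
Proof.
apply/eqP => /ffunP /(_ 1%g); rewrite !ffunE eqxx => /eqP.
by rewrite oner_eq0.
Qed.

HB.instance Definition _ := GRing.Zmodule_isNzRing.Build skew_galg
  skew_mulA skew_mul1 skew_mulr1 skew_mulDl skew_mulDr skew_one_neq0.

Lemma skew_scalerAl (a : k) (u v : skew_galg) : a *: (u * v) = (a *: u) * v.
Proof.
apply/ffunP => x; rewrite !ffunE scaler_sumr; apply: eq_bigr => g _.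
by rewrite ffunE scalerAl.
Qed.

Lemma skew_scalerAr (a : k) (u v : skew_galg) : a *: (u * v) = u * (a *: v).
Proof.
apply/ffunP => x; rewrite !ffunE scaler_sumr; apply: eq_bigr => g _.
by rewrite ffunE linearZ scalerAr.
Qed.

HB.instance Definition _ :=
  GRing.Lmodule_isLalgebra.Build k skew_galg skew_scalerAl.
HB.instance Definition _ :=
  GRing.Lalgebra_isAlgebra.Build k skew_galg skew_scalerAr.

Definition skew_in (v : V) : skew_galg := skew_elt (sym_in v) 1%g.

(* {}^h (s g) = ({}^h s) h g h^-1, extended linearly *)
Definition skew_act (h : gT) (a : skew_galg) : skew_galg :=
  [ffun x => sym_map (rho h) (a (h^-1 * x * h)%g)].

Lemma skew_act_elt h s g :
  skew_act h (skew_elt s g) = skew_elt (sym_map (rho h) s) (h * g * h^-1)%g.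
Proof.
apply/ffunP => x; rewrite !ffunE.
rewrite -(inj_eq (mulgI h)) mulgA mulKVg -(inj_eq (mulIg h^-1%g)) mulgK.
by case: eqP => // _; rewrite linear0.
Qed.

End SkewGroupAlgebra.

Section KoszulCochains.
Variables (k : fieldType) (gT : finGroupType) (V : vectType k).
Variable rho : linear_rep gT V.
Local Notation SG := (skew_galg rho).

(* Hom_k(/\^p V, S # G) is the space of alternating multilinear maps; the
   component alpha_g of alpha is v |-> (alpha v) g. *)
Definition kcochain (p : nat) (alpha : ('I_p -> V) -> SG) : Prop :=
  multilinear alpha /\
  (forall v (i j : 'I_p), i != j -> v i = v j -> alpha v = 0).

Definition kdiff (p : nat) (alpha : ('I_p -> V) -> SG)
    (v : 'I_p.+1 -> V) : SG :=
  \sum_(i < p.+1) (-1) ^+ i *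
    (skew_in rho (v i) * alpha (fun j => v (lift i j))
     - alpha (fun j => v (lift i j)) * skew_in rho (v i)).

Definition kcoboundary (p : nat) : (('I_p -> V) -> SG) -> Prop :=
  match p return (('I_p -> V) -> SG) -> Prop with
  | 0 => fun alpha => forall v, alpha v = 0
  | q.+1 => fun alpha => exists2 delta : ('I_q -> V) -> SG,
      kcochain delta & forall v, alpha v = kdiff delta v
  end.

Definition kinvariant (p : nat) (alpha : ('I_p -> V) -> SG) : Prop :=
  forall (h : gT) (v : 'I_p -> V),
    skew_act h (alpha (fun i => rho h^-1%g (v i))) = alpha v.

Definition kconstant (p : nat) (alpha : ('I_p -> V) -> SG) : Prop :=
  forall v (g : gT), alpha v g \is 0.-homog.

Definition klinear (p : nat) (alpha : ('I_p -> V) -> SG) : Prop :=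
  forall v (g : gT), alpha v g \is 1.-homog.

Definition kdegree_le1 (p : nat) (alpha : ('I_p -> V) -> SG) : Prop :=
  exists alpha0 alpha1 : ('I_p -> V) -> SG,
    [/\ kcochain alpha0 /\ kconstant alpha0,
        kcochain alpha1 /\ klinear alpha1 &
        forall v, alpha v = alpha0 v + alpha1 v].

Definition codim_fixed (g : gT) : nat :=
  (\dim {:V} - \dim (fixedSpace (rho g)))%N.

(* (V^g)^\perp: sums of eigenvectors of g with eigenvalues distinct from 1 *)
Definition fixed_perp (g : gT) (v : V) : Prop :=
  exists (n : nat) (w : 'I_n -> V) (a : 'I_n -> k),
    (forall i, a i != 1 /\ rho g (w i) = a i *: w i) /\ v = \sum_i w i.

(* The value of xi_0 /\ ... /\ xi_{p-1} at v_0 /\ ... /\ v_{p-1}. *)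
Definition wedge (p : nat) (xi : 'I_p -> 'Hom(V, k^o)) (v : 'I_p -> V) : k :=
  \det (\matrix_(i, j) (xi i (v j) : k)).

(* s g (x) xi_0 /\ ... /\ xi_{p-1} is a generator of the g-component of H^p.
   (V^g)^* and ((V^g)^\perp)^* sit in V^* as the annihilators of (V^g)^\perp
   and of V^g; there is no generator when p < codim V^g. *)
Definition Hgenerator (p : nat) (g : gT) (s : Sym V)
    (xi : 'I_p -> 'Hom(V, k^o)) : Prop :=
  [/\ (codim_fixed g <= p)%N,
      sym_sub (fixedSpace (rho g)) s,
      forall i : 'I_p, (i < p - codim_fixed g)%N ->
        forall v, fixed_perp g v -> xi i v = 0 &
      forall i : 'I_p, (p - codim_fixed g <= i)%N ->
        forall v, v \in fixedSpace (rho g) -> xi i v = 0].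

Definition in_H (p : nat) (alpha : ('I_p -> V) -> SG) : Prop :=
  forall g : gT, exists (n : nat) (s : 'I_n -> Sym V)
      (xi : 'I_n -> 'I_p -> 'Hom(V, k^o)),
    (forall l, Hgenerator g (s l) (xi l)) /\
    forall v, alpha v g = \sum_(l < n) wedge (xi l) v *: s l.

(* Restriction of a cochain on the bar resolution from S # G to S, composed
   with the antisymmetrisation map from the Koszul to the bar resolution. *)
Definition koszul_restrict (p : nat) (f : ('I_p -> SG) -> SG) (v : 'I_p -> V) : SG :=
  \sum_(s : 'S_p) (-1) ^+ s * f (fun i => skew_in rho (v (s i))).

(* Since koszul_restrict maps coboundaries to coboundaries, the last condition
   does not depend on the cocycle f chosen in the class c. *)
Definition represents (p : nat) (gamma : ('I_p -> V) -> SG) (c : HH SG p) :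
    Prop :=
  [/\ kcochain gamma,
      forall v, kdiff gamma v = 0 &
      exists2 f : hcocycle SG p, \pi_(HH SG p) f = c &
        kcoboundary (fun v => koszul_restrict f v - gamma v)].

Definition half_bracket (alpha beta : ('I_2 -> V) -> SG) (v : 'I_3 -> V) : SG :=
  \sum_(g : gT) \sum_(h : gT) \sum_(s in ('Alt_('I_3))%g)
    skew_elt rho
      (alpha (pair2 (sym_lin (beta (pair2 (v (s 0)) (v (s 1))) h)) (v (s 2)))
         (g * h^-1)%g) g.

(* As [sym_lin] kills constants, this is symmetric and bilinear and covers all
   three cases (linear/linear, constant/linear, constant/constant) at once;
   cf. cochain_bracket_constant_linear and cochain_bracket_constant. *)
Definition cochain_bracket (alpha beta : ('I_2 -> V) -> SG)
    (v : 'I_3 -> V) : SG :=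
  half_bracket alpha beta v + half_bracket beta alpha v.

Lemma sym_linC (s : Sym V) : s \is 0.-homog -> sym_lin s = 0.
Proof.
move=> /dhomogP s0; rewrite /sym_lin big1 // => i _.
rewrite memN_msupp_eq0 ?scale0r //; apply/negP => /s0.
by rewrite /= mdeg1.
Qed.

Lemma half_bracket_constant (alpha beta : ('I_2 -> V) -> SG) v :
  kcochain alpha -> kconstant beta -> half_bracket alpha beta v = 0.
Proof.
move=> [la _] cb; rewrite /half_bracket big1 // => g _; rewrite big1 // => h _.
rewrite big1 // => s _; rewrite sym_linC //.
have [_ /(_ 0 0)] := linearDB (pair2_linl la (v (s 2))).
by rewrite !subrr => ->; apply/ffunP => x; rewrite !ffunE if_same.
Qed.

Lemma cochain_bracket_constant_linear alpha beta v :
  kcochain beta -> kconstant alpha ->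
  cochain_bracket alpha beta v = half_bracket alpha beta v.
Proof.
by move=> lb ca; rewrite /cochain_bracket (half_bracket_constant _ lb ca) addr0.
Qed.

Lemma cochain_bracket_constant alpha beta v :
  kcochain alpha -> kcochain beta -> kconstant alpha -> kconstant beta ->
  cochain_bracket alpha beta v = 0.
Proof.
move=> la lb ca cb.
by rewrite cochain_bracket_constant_linear // half_bracket_constant.
Qed.

End KoszulCochains.

(* k contains the eigenvalues of g iff the characteristic polynomial of g,
   acting on V, is a product of linear factors over k. *)
Definition eigenvalues_in_field (k : fieldType) (gT : finGroupType)
    (V : vectType k) (rho : linear_rep gT V) : Prop :=
  forall g : gT, exists rs : seq k,
    char_poly (passmx.mxof (vbasis {:V}) (vbasis {:V}) (rho g)) =
    \prod_(r <- rs) ('X - r%:P).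

(* Main.v *)
Require Import Defs.
From mathcomp Require Import all_boot all_order all_algebra all_fingroup.
From mathcomp Require Import all_solvable.
From mathcomp Require Import mpoly boolp zify.

Set Implicit Arguments.
Unset Strict Implicit.
Unset Printing Implicit Defensive.

Import GRing.Theory.
Local Open Scope ring_scope.

(** The idea is to compute the Gerstenhaber bracket on bar cocycles so well
    adapted to alpha and beta that the restriction of their bracket to the
    Koszul complex equals the cochain bracket on the nose.

    Since |G| is invertible, averaging over G replaces any bar 2-cocycle on
    S # G by a cohomologous one that vanishes as soon as one argument lies in G
    ([cohomologous_to_normalized]).  The cocycle identity then forces such a
    normalized m to be kG-bilinear and kG-balanced.  The restriction of m to V,
    that is m(v, w) - m(w, v), is G-invariant and differs from the G-invariant
    cochain alpha by the Koszul differential of a linear map d : V -> S # G; the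
    average of d over G extends to a kG-bilinear map of S # G into itself, and
    subtracting its differential makes m(v, w) - m(w, v) equal to alpha(v, w)
    while keeping m normalized ([exact_representative]).

    Let m and n be such cocycles for alpha and beta.  Antisymmetrizing m o n
    over three vectors leaves the sum over the cyclic rotations of (x, y, z) of
      m(beta(x, y), z) - m(z, beta(x, y)).
    Write beta(x, y) as the sum over h of (c_h + b_h) h with c_h a constant and
    b_h in V.  Normalization kills c_h, and moving h through m gives
      m(b_h h, z) - m(z, b_h h) = alpha(b_h, z) h + m(b_h, hz - z) h.
    The first terms are those of the cochain bracket.  It remains to see that
    the second ones cancel over the rotations for each h.  The h-component of
    the Koszul cocycle condition on beta says that the products
    (c_h + b_h)(hz - z) add up to 0 in S.  Now beta lies in H^2, so b_h is fixed
    by h, while hz - z lies in the complement (h - 1)V of the fixed space of h;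
    hence the multiplication from the tensor product of V^h and (h - 1)V to S
    is injective, and the vanishing persists after replacing the product by any
    bilinear map ([sum_fixed_moved_eq0]), for instance by m.

    That the result is an alternating cocycle holds for the restriction of any
    Hochschild cocycle ([koszul_restrict_kcochain], [koszul_restrict_hdiff]). *)

(** Proves an identity in an additive group whose terms cancel in pairs once
    everything is on the left. *)
Ltac zcancel :=
  apply/eqP; rewrite -subr_eq0; apply/eqP;
  rewrite ?(opprD, opprK, addrA, subr0) -[LHS]add0r ?addrA;
  repeat match goal with
    |- context [ - ?x ] =>
        do ?[rewrite (addrAC _ x)]; do ?[rewrite (addrAC _ (- x))];
        first [rewrite addrK | rewrite subrK]
    end.

(** * Linear and bilinear maps *)

Section LinearMaps.
Variables (k : fieldType) (U W : lmodType k).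

Lemma multilinear_pair (F : U -> U -> W) :
  (forall x, linear (F x)) -> (forall y, linear (F^~ y)) ->
  multilinear (fun r : 'I_2 -> U => F (r 0) (r 1)).
Proof.
by move=> lr ll [[|[|[|//]]] i] u a x y; rewrite /= ?(lr _ a x y) ?(ll _ a x y).
Qed.

Lemma multilinear_fun1 (L : U -> W) :
  linear L -> multilinear (fun r : 'I_1 -> U => L (r 0)).
Proof. by move=> lL i u a x y; rewrite (ord1 i) /= lL. Qed.

Lemma linear_of_fun1 (f : ('I_1 -> U) -> W) :
  multilinear f -> linear (fun x => f (fun=> x)).
Proof.
have E (x z : U) : ([eta (fun=> z) with 0 |-> x] : 'I_1 -> U) = (fun=> x).
  by apply/funext => j; rewrite /= ord1.
by move=> lf a x y; have := lf 0 (fun=> 0) a x y; rewrite !E.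
Qed.

Lemma fun_pair2 (T : Type) (u : T -> U) (x y : T) :
  (fun i : 'I_2 => u (pair2 x y i)) = pair2 (u x) (u y).
Proof. by apply/funext => -[[|[|//]] i]; rewrite /pair2 !(tnth_nth (u x)). Qed.

Lemma linear_fun0 (L : U -> W) : linear L -> L 0 = 0.
Proof. by move=> /linearDB [_ LB]; rewrite -(subrr 0) LB subrr. Qed.

Lemma linear_funZ (L : U -> W) c x : linear L -> L (c *: x) = c *: L x.
Proof. by move=> lL; rewrite -[c *: x]addr0 lL (linear_fun0 lL) addr0. Qed.

Lemma linear_fun_sum (L : U -> W) I (r : seq I) (P : pred I) (F : I -> U) :
  linear L -> L (\sum_(i <- r | P i) F i) = \sum_(i <- r | P i) L (F i).
Proof.
move=> lL; apply: (big_morph L); last exact: linear_fun0.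
by have [] := linearDB lL.
Qed.

Lemma linear_scaled_sum I (r : seq I) (c : k) (F : I -> U -> W) :
  (forall i, linear (F i)) -> linear (fun x => c *: \sum_(i <- r) F i x).
Proof.
move=> lF a x y; rewrite (eq_bigr _ (fun i _ => lF i a x y)) big_split /=.
by rewrite -scaler_sumr scalerDr !scalerA mulrC.
Qed.

End LinearMaps.

(** * Hochschild cocycles normalized relative to a finite group *)

Section NormalizedCocycles.
Variables (k : fieldType) (A : algType k).
Implicit Types (m : hcocycle A 2) (L : A -> A).

Lemma hcocycle2E m x y z :
  x * m (pair2 y z) - m (pair2 (x * y) z) + m (pair2 x (y * z))
  - m (pair2 x y) * z = 0.
Proof. by rewrite -hdiff2E; exact: hcocycle_closed. Qed.

Lemma cohomologous_sub m L : linear L ->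
  exists2 m' : hcocycle A 2, \pi_(HH A 2)%qT m' = \pi_(HH A 2)%qT m &
    forall x y,
      m' (pair2 x y) = m (pair2 x y) - (x * L y - L (x * y) + L x * y).
Proof.
move=> lL; have [LD LB] := linearDB lL.
pose dL x y := x * L y - L (x * y) + L x * y.
pose f (r : 'I_2 -> A) := m r - dL (r 0) (r 1).
have ldL : multilinear (fun r : 'I_2 -> A => dL (r 0) (r 1)).
  apply: multilinear_pair => z a x y; rewrite /dL lL.
    rewrite !mulrDr -!scalerAr lL scalerDr scalerBr opprD.
    by rewrite [RHS]addrACA; congr (_ + _); rewrite addrACA.
  rewrite !mulrDl -!scalerAl lL scalerDr scalerBr opprD.
  by rewrite [RHS]addrACA; congr (_ + _); rewrite addrACA.
have lf : multilinear f.
  by apply: multilinearB => //; exact: hcocycle_multilinear.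
have cf r : hdiff f r = 0.
  rewrite hdiffB (hcocycle_closed m) sub0r (tuple3E r); apply/eqP.
  rewrite oppr_eq0; apply/eqP; rewrite hdiff2E.
  move: (r 0) (r 1) (r 2) => x y z; rewrite /dL /pair2 /= !(tnth_nth 0) /=.
  rewrite !mulrDr !mulrDl !mulrN !mulNr !mulrA !opprD !opprK !addrA.
  by zcancel.
exists (HCocycle lf cf) => //; apply/eqquotP/asboolP.
exists (fun r => - L (r 0)).
  apply: (@multilinear_fun1 _ _ _ (fun x => - L x)) => a x y.
  by rewrite lL opprD scalerN.
move=> r; rewrite [r]pair2E hdiff1E /= /f /dL addrC addKr.
by rewrite mulrN mulNr !opprD !opprK.
Qed.

Variables (gT : finGroupType) (e : gT -> A).
Hypotheses (e1 : e 1%g = 1) (eM : forall g h, e (g * h)%g = e g * e h).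
Hypothesis card_neq0 : (#|gT|%:R : k) != 0.

Definition normalized m :=
  forall g x, m (pair2 (e g) x) = 0 /\ m (pair2 x (e g)) = 0.

Lemma average_const (W : lmodType k) (w : W) :
  (#|gT|%:R : k)^-1 *: \sum_(h : gT) w = w.
Proof. by rewrite sumr_const -scaler_nat scalerA mulVf ?scale1r. Qed.

(** Averaging the cocycle identity at (h, g, x), multiplied by the inverse of h,
    over all h shows that m(g, x) is the differential of L at (g, x). *)
Lemma normalize_left m :
  exists2 m' : hcocycle A 2, \pi_(HH A 2)%qT m' = \pi_(HH A 2)%qT m &
    forall g x, m' (pair2 (e g) x) = 0.
Proof.
have lm := hcocycle_multilinear m.
have eVK g : e g^-1%g * e g = 1 by rewrite -eM mulVg.
pose L x := (#|gT|%:R : k)^-1 *: \sum_(h : gT) e h^-1%g * m (pair2 (e h) x).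
have lL : linear L.
  apply: linear_scaled_sum => h a x y.
  by rewrite (pair2_linr lm) mulrDr scalerAr.
have [m' Em' m'E] := cohomologous_sub m lL; exists m' => // g x.
apply/eqP; rewrite m'E subr_eq0; apply/eqP.
have eL z : e g * L z =
    (#|gT|%:R : k)^-1 *: \sum_(h : gT) e h^-1%g * m (pair2 (e (h * g)%g) z).
  rewrite -scalerAr mulr_sumr (reindex_inj (mulIg g)) /=; congr (_ *: _).
  by apply: eq_bigr => h _; rewrite mulrA -eM invMg mulKVg.
rewrite eL -[LHS]average_const /L -!scalerAl mulr_suml -scalerBr -scalerDr.
rewrite -sumrB -big_split /=; congr (_ *: _); apply: eq_bigr => h _.
rewrite -{1}[m (pair2 _ _)]mul1r -(eVK h) -!mulrA -mulrBr -mulrDr.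
congr (_ * _); apply/eqP.
rewrite eM -subr_eq0 -[X in _ == X](hcocycle2E m (e h) (e g) x).
by rewrite opprD opprB !addrA [X in X - _ == _]addrAC.
Qed.

(** Averaging on the right as in [normalize_left] starts from a cocycle that
    commutes with left multiplication by G, so the correcting map L does too,
    and its differential still vanishes when the first argument is in G. *)
Lemma cohomologous_to_normalized m :
  exists2 m' : hcocycle A 2,
    \pi_(HH A 2)%qT m' = \pi_(HH A 2)%qT m & normalized m'.
Proof.
have [m1 <- m1l] := normalize_left m; have lm := hcocycle_multilinear m1.
have eKV g : e g * e g^-1%g = 1 by rewrite -eM mulgV.
pose L x := (#|gT|%:R : k)^-1 *: \sum_(h : gT) m1 (pair2 x (e h)) * e h^-1%g.
have lL : linear L.
  apply: linear_scaled_sum => h a x y.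
  by rewrite (pair2_linl lm) mulrDl scalerAl.
have m1Z g x y : m1 (pair2 (e g * x) y) = e g * m1 (pair2 x y).
  have := hcocycle2E m1 (e g) x y; rewrite !m1l mul0r subr0 addr0.
  by move/eqP; rewrite subr_eq0 => /eqP.
have LZ g x : L (e g * x) = e g * L x.
  rewrite /L -scalerAr mulr_sumr; congr (_ *: _); apply: eq_bigr => h _.
  by rewrite m1Z mulrA.
have L0 g : L (e g) = 0 by rewrite /L big1 ?scaler0 // => h _; rewrite m1l mul0r.
have [m' Em' m'E] := cohomologous_sub m1 lL; exists m' => // g x.
rewrite !m'E m1l LZ !L0 mul0r mulr0 addr0 sub0r subrr oppr0; split=> //.
have Le : L x * e g =
    (#|gT|%:R : k)^-1 *: \sum_(h : gT) m1 (pair2 x (e (g * h)%g)) * e h^-1%g.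
  rewrite /L -scalerAl mulr_suml (reindex_inj (mulgI g)) /=; congr (_ *: _).
  by apply: eq_bigr => h _; rewrite -mulrA -eM invMg mulgKV.
apply/eqP; rewrite Le subr_eq0; apply/eqP.
rewrite -[LHS]average_const /L addrC sub0r -scalerBr.
rewrite -sumrB /=; congr (_ *: _); apply: eq_bigr => h _.
rewrite -{1}[m1 (pair2 _ _)]mulr1 -(eKV h) !mulrA -mulrBl.
congr (_ * _); apply/eqP.
rewrite eM -subr_eq0 -oppr0 -[X in _ == - X](hcocycle2E m1 x (e g) (e h)).
by rewrite m1l mulr0 sub0r; apply/eqP; zcancel.
Qed.

Section Bilinearity.
Variable m : hcocycle A 2.
Hypothesis m0 : normalized m.

Lemma normalizedMl g x y : m (pair2 (e g * x) y) = e g * m (pair2 x y).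
Proof.
have := hcocycle2E m (e g) x y; rewrite !(proj1 (m0 g _)) mul0r subr0 addr0.
by move/eqP; rewrite subr_eq0 => /eqP.
Qed.

Lemma normalizedMr g x y : m (pair2 x (y * e g)) = m (pair2 x y) * e g.
Proof.
have := hcocycle2E m x y (e g); rewrite !(proj2 (m0 g _)) mulr0 subr0 add0r.
by move/eqP; rewrite subr_eq0 => /eqP.
Qed.

Lemma normalized_balanced g x y :
  m (pair2 (x * e g) y) = m (pair2 x (e g * y)).
Proof.
have := hcocycle2E m x (e g) y.
rewrite (proj1 (m0 g _)) (proj2 (m0 g _)) mulr0 mul0r sub0r subr0 addrC.
by move/eqP; rewrite subr_eq0 => /eqP.
Qed.

End Bilinearity.

End NormalizedCocycles.

(** * Signed sums over symmetric groups *)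

Section SignedSums.
Variables (R : pzRingType) (n : nat).

Lemma signed_sum_eq0 (t : 'S_n -> 'S_n) (F : 'S_n -> R) :
  injective t -> (forall s, t s = ~~ s :> bool) -> (forall s, F (t s) = F s) ->
  \sum_(s : 'S_n) (-1) ^+ s * F s = 0.
Proof.
move=> injt oddt Ft; rewrite (bigID (@odd_perm _)) /=.
rewrite (reindex_inj injt) -[X in X + _]opprK -[X in - X + _]sumrN.
apply/eqP; rewrite addrC subr_eq0; apply/eqP; apply: eq_big => [s|s].
  by rewrite oddt.
by move=> /negPf os; rewrite oddt Ft os mulN1r mul1r opprK.
Qed.

Lemma sum_lift_perm (i0 : 'I_n.+1) (F : 'S_n.+1 -> R) :
  \sum_(s : 'S_n.+1) F s =
  \sum_(i < n.+1) \sum_(t : 'S_n) F (lift_perm i0 i t).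
Proof.
rewrite pair_bigA /= (reindex (fun p => lift_perm i0 p.1 p.2)) //=.
apply: onW_bij; apply: inj_card_bij; last first.
  by rewrite card_prod card_ord !card_Sn factS.
move=> [i s] [j t] /= E; have Eij : i = j.
  by rewrite -(lift_perm_id i0 i s) E lift_perm_id.
rewrite Eij in E *; congr (_, _); apply/permP => l.
apply: (@lift_inj _ j).
by rewrite -(lift_perm_lift i0 j s) -(lift_perm_lift i0 j t) E.
Qed.

End SignedSums.

Section SmallSymmetricGroups.
Variable R : pzRingType.

(** The boolean argument of F in [sum_S2] and [sum_S3] is the parity of the
    permutation, so that signed sums and sums over even permutations are both
    instances. *)
Lemma sum_S2 (F : bool -> 'I_2 -> 'I_2 -> R) :
  \sum_(s : 'S_2) F s (s 0) (s 1) = F false 0 1 + F true 1 0.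
Proof.
rewrite (sum_lift_perm 0) !big_ord_recl big_ord0 addr0.
have S1 (G : 'S_1 -> R) : \sum_(s : 'S_1) G s = G 1%g.
  rewrite (bigD1 1%g) //= big1 ?addr0 // => s /eqP[].
  by apply/permP => i; rewrite !ord1.
have one : (1 : 'I_2) = lift 0 (0 : 'I_1) by apply: val_inj.
rewrite !S1 !odd_lift_perm !odd_perm1 !lift_perm_id one !lift_perm_lift.
by rewrite !perm1 /=; congr (F _ _ _ + F _ _ _); apply: val_inj.
Qed.

Lemma sum_S3 (F : bool -> 'I_3 -> 'I_3 -> 'I_3 -> R) :
  \sum_(s : 'S_3) F s (s 0) (s 1) (s 2) =
  F false 0 1 2 + F true 0 2 1 + (F true 1 0 2 + F false 1 2 0)
  + (F false 2 0 1 + F true 2 1 0).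
Proof.
have E1 : (1 : 'I_3) = lift 0 (0 : 'I_2) by apply: val_inj.
have E2 : (2 : 'I_3) = lift 0 (1 : 'I_2) by apply: val_inj.
rewrite (sum_lift_perm 0) !big_ord_recl big_ord0 addr0 addrA.
have S (i : 'I_3) : \sum_(t : 'S_2) F (lift_perm 0 i t) (lift_perm 0 i t 0)
      (lift_perm 0 i t 1) (lift_perm 0 i t 2) =
    F (odd i) i (lift i 0) (lift i 1) + F (~~ odd i) i (lift i 1) (lift i 0).
  have := sum_S2 (fun b x y => F (odd i (+) b) i (lift i x) (lift i y)).
  rewrite /= addbF addbT => <-; apply: eq_bigr => t _.
  rewrite odd_lift_perm lift_perm_id {1}E1 {1}E2.
  by rewrite !lift_perm_lift.
by rewrite !S; congr (F _ _ _ _ + F _ _ _ _ + (F _ _ _ _ + F _ _ _ _)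
  + (F _ _ _ _ + F _ _ _ _)); apply: val_inj.
Qed.

Lemma sum_Alt3 (F : 'I_3 -> 'I_3 -> 'I_3 -> R) :
  \sum_(s in ('Alt_('I_3))%g) F (s 0) (s 1) (s 2) =
  F 0 1 2 + F 1 2 0 + F 2 0 1.
Proof.
rewrite big_mkcond.
transitivity (\sum_(s : 'S_3) (if ~~ s then F (s 0) (s 1) (s 2) else 0)).
  by apply: eq_bigr => s _; rewrite Alt_even.
rewrite (sum_S3 (fun b x y z => if ~~ b then F x y z else 0)) /=.
by rewrite !addr0 add0r.
Qed.

Lemma alternating_sum2 (F : 'I_2 -> R) :
  \sum_(i < 2) (-1) ^+ i * F i = F 0 - F 1.
Proof.
rewrite !big_ord_recl big_ord0 addr0 /= mul1r expr1 mulN1r.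
by congr (F _ - F _); apply: val_inj.
Qed.

Lemma alternating_sum3 (F : 'I_3 -> R) :
  \sum_(i < 3) (-1) ^+ i * F i = F 0 - F 1 + F 2.
Proof.
rewrite !big_ord_recl big_ord0 addr0 /= mul1r expr1 mulN1r sqrrN expr1n.
by rewrite mul1r addrA; congr (F _ - F _ + F _); apply: val_inj.
Qed.

End SmallSymmetricGroups.

(** * Antisymmetrization of Hochschild cochains *)

Section Antisymmetrization.
Variables (k : fieldType) (A : algType k).

(** An inner term of the Hochschild differential multiplies two neighbouring
    arguments; swapping them changes the sign of the permutation but not the
    value, so only the two outer terms survive.  These are indexed by the
    argument standing alone on the left, respectively on the right. *)
Lemma antisymmetrized_hdiff p (f : ('I_p -> A) -> A) (x : 'I_p.+1 -> A) :
  (forall i j, x i * x j = x j * x i) ->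
  \sum_(s : 'S_p.+1) (-1) ^+ s * hdiff f (fun i => x (s i)) =
  \sum_(i < p.+1) (-1) ^+ i *
    (x i * (\sum_(t : 'S_p) (-1) ^+ t * f (fun j => x (lift i (t j))))
     - (\sum_(t : 'S_p) (-1) ^+ t * f (fun j => x (lift i (t j)))) * x i).
Proof.
move=> xC; rewrite /hdiff.
rewrite (eq_bigr _ (fun s _ => mulrDr _ _ _)) big_split /=.
rewrite (eq_bigr _ (fun s _ => mulrDr _ _ _)) big_split /=.
rewrite [X in _ + X + _](_ : _ = 0) ?addr0; last first.
  under eq_bigr => s _ do rewrite mulr_sumr.
  rewrite exchange_big big1 //= => i _.
  pose t := tperm (lift ord_max i) (lift ord0 i).
  apply: (@signed_sum_eq0 _ _ (fun s => t * s)%g).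
  - exact: mulgI.
  - move=> s; rewrite odd_permM odd_tperm.
    by rewrite -(inj_eq val_inj) [val _]lift_max [val _]lift0 ltn_eqF.
  move=> s; congr (_ * f _); apply/funext => j.
  have tE (l : 'I_p.+1) : l != i :> nat -> l != i.+1 :> nat -> (t * s)%g l = s l.
    move=> li liS; rewrite permM tpermD // -(inj_eq val_inj) eq_sym;
      by rewrite ?[val (lift ord_max _)]lift_max ?[val (lift ord0 _)]lift0.
  case: ltngtP => [ji|ji|ji]; rewrite -?val_eqE /=.
  - by rewrite tE // lift_max; lia.
  - by rewrite (gtn_eqF ji) tE // lift0; lia.
  have -> : j = i by apply: val_inj.
  by rewrite eqxx !permM tpermL tpermR xC.
rewrite (sum_lift_perm ord0) [X in _ + X](sum_lift_perm ord_max) -big_split /=.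
apply: eq_bigr => i _.
rewrite mulr_sumr mulr_suml -sumrB mulr_sumr -big_split /=.
apply: eq_bigr => t _; rewrite !lift_perm_id.
have E j : (fun l : 'I_p => x (lift_perm j i t (lift j l))) =
    (fun l => x (lift i (t l))).
  by apply/funext => l; rewrite lift_perm_lift.
rewrite !E mulrBr.
rewrite !odd_lift_perm /= -[(-1) ^+ p.+1]signr_odd -[(-1) ^+ i]signr_odd /=.
case: (odd p); case: (odd i); case: (odd_perm t) => /=;
  by rewrite ?(expr0, expr1, mulN1r, mul1r, mulrN, mulNr, opprK).
Qed.

Lemma antisymmetrized_hcirc (m n : ('I_2 -> A) -> A) (x : 'I_3 -> A) :
  multilinear m ->
  let c a b := n (pair2 a b) - n (pair2 b a) in
  let t a b d := m (pair2 (c a b) d) - m (pair2 d (c a b)) in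
  \sum_(s : 'S_3) (-1) ^+ s * hcirc m n (fun i => x (s i)) =
  t (x 0) (x 1) (x 2) + t (x 1) (x 2) (x 0) + t (x 2) (x 0) (x 1).
Proof.
move=> lm c t.
rewrite (eq_bigr (fun s : 'S_3 => (-1) ^+ s *
    hcirc m n (tnth [tuple x (s 0); x (s 1); x (s 2)]))); last first.
  by move=> s _; congr (_ * hcirc m n _); rewrite [LHS]tuple3E.
rewrite (sum_S3 (fun b i j l =>
  (-1) ^+ b * hcirc m n (tnth [tuple x i; x j; x l]))).
rewrite /= !mul1r !mulN1r !hcirc_tuple /t /c !(pair2Bl lm) !(pair2Br lm).
by zcancel.
Qed.

End Antisymmetrization.

(** * Commutators and conjugation *)

Section Commutators.
Variable R : pzRingType.
Implicit Types u v a b x y : R.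

Definition commr a b := a * b - b * a.

Lemma commr_sub_add a b c d x y :
  commr x (a + b) - commr y (c + d) =
  (commr x a - commr y c) + (commr x b - commr y d).
Proof. by rewrite /commr !mulrDr !mulrDl; zcancel. Qed.

Lemma commr_scaled_sum (k : fieldType) (A : algType k) (I : finType) (x : A)
    (F : I -> A) (c : k) :
  x * (c *: \sum_i F i) - (c *: \sum_i F i) * x =
  c *: \sum_i (x * F i - F i * x).
Proof. by rewrite -scalerAr -scalerAl mulr_sumr mulr_suml sumrB scalerBr. Qed.

(** The antisymmetrized Hochschild differential, at commuting x and y, of a map
    with values lx at x, ly at y and lxy at their product. *)
Lemma antisymmetrized_hdiff1 x y lx ly lxy :
  (x * ly - lxy + lx * y) - (y * lx - lxy + ly * x) = commr x ly - commr y lx.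
Proof. by rewrite /commr; zcancel. Qed.

Lemma diff_eq_of_corrected a b a' b' al c :
  a - b - (a' - b') - al = c -> a - a' = al + (c + (b - b')).
Proof. by move=> <-; zcancel. Qed.

Lemma corrected_diff_eq a b a' b' al c :
  a - a' = al + c -> b - b' = c -> a - b - (a' - b') = al.
Proof.
move=> E Ec.
by rewrite opprD opprK addrACA E [- b + _]addrC -opprB Ec addrK.
Qed.

Lemma sum3_opp_eq0 a b c : - a + - b + - c = 0 -> c + (a + b) = 0.
Proof. by rewrite -!opprD => /eqP; rewrite oppr_eq0 addrC => /eqP. Qed.

Lemma conjrB u v a b : u * a * v - u * b * v = u * (a - b) * v.
Proof. by rewrite mulrBr mulrBl. Qed.

Lemma conjrKV u v a : v * u = 1 -> v * (u * a * v) * u = a.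
Proof. by move=> vu; rewrite !mulrA vu mul1r -mulrA vu mulr1. Qed.

Lemma commrJ u v a b : v * u = 1 ->
  commr (u * a * v) (u * b * v) = u * commr a b * v.
Proof.
move=> vu; have E x y : u * x * v * (u * y * v) = u * (x * y) * v.
  by rewrite !mulrA -(mulrA (u * x)) vu mulr1.
by rewrite /commr !E conjrB.
Qed.

End Commutators.

(** * The symmetric algebra in degrees at most two *)

Section SymmetricAlgebraFacts.
Variables (k : fieldType) (V : vectType k).
Local Notation S := (Defs.Sym V).
Local Notation n := (\dim {:V}).
Local Notation e := (vbasis {:V}).

Lemma sym_lin_linear : linear (@sym_lin k V).
Proof.
move=> a x y; rewrite /sym_lin scaler_sumr -big_split; apply: eq_bigr => i _ /=.
by rewrite mcoeffD mcoeffZ scalerDl scalerA.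
Qed.

Lemma sym_lin_in (v : V) : sym_lin (sym_in v) = v.
Proof.
rewrite [in RHS](coord_vbasis (memvf v)); apply: eq_bigr => i _; congr (_ *: _).
rewrite linear_sum (bigD1 i) //= mcoeffZ mcoeffXU eqxx mulr1 big1 ?addr0 //.
by move=> j /negPf ji; rewrite mcoeffZ mcoeffXU ji mulr0.
Qed.

Lemma sym_lin_1 : sym_lin (1 : S) = 0.
Proof. by rewrite sym_linC // dhomog1. Qed.

Lemma sym_in0 (v : V) : (sym_in v)@_0 = 0.
Proof.
rewrite raddf_sum big1 // => i _ /=; rewrite mcoeffZ mcoeffX.
by rewrite mnm1_eq0 mulr0.
Qed.

Lemma homog1_sym_in (s : S) : s \is 1.-homog -> s = sym_in (sym_lin s).
Proof.
move=> s1; rewrite /sym_lin linear_sum /=.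
under eq_bigr => i _ do rewrite linearZ /= sym_inX.
apply/mpolyP => m; rewrite raddf_sum /=.
have [/eqP/mdeg1P[i /eqP ->]|m1] := eqVneq (mdeg m) 1%N.
  rewrite (bigD1 i) //= mcoeffZ mcoeffXU eqxx mulr1 big1 ?addr0 // => j ji.
  by rewrite mcoeffZ mcoeffXU (negPf ji) mulr0.
rewrite (dhomog_nemf_coeff s1) ?big1 // => i _; rewrite mcoeffZ mcoeffX.
by case: (U_(i)%MM =P m) m1 => [<-|]; rewrite ?mulr0 // mdeg1.
Qed.

Lemma homog0_const (s : S) : s \is 0.-homog -> s = s@_0 *: 1.
Proof.
move=> s0; rewrite -[X in _ = X]mul_mpolyC mulr1.
apply/mpolyP => m; rewrite mcoeffC.
case: eqP => [->|/eqP m0]; first by rewrite mulr1.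
rewrite mulr0; apply: (dhomog_nemf_coeff s0).
by rewrite /= mdeg_eq0.
Qed.

(** The linear part is a derivation over the evaluation at the origin. *)
Lemma sym_linM (s t : S) :
  sym_lin (s * t) = t@_0 *: sym_lin s + s@_0 *: sym_lin t.
Proof.
have D (u : S) i : u@_U_(i) = (mderiv i u)@_0.
  by rewrite mcoeff_deriv mnm0E add0m mulr1n.
rewrite /sym_lin !scaler_sumr -big_split; apply: eq_bigr => i _ /=.
rewrite !D mderivM mcoeffD !rmorphM /= scalerDl !scalerA.
by rewrite [t@_0 * _]mulrC.
Qed.

(** By [sym_linM] the property is multiplicative, provided that the constant
    terms are followed along. *)
Lemma sym_lin_map (f : 'End(V)) (s : S) :
  sym_lin (sym_map f s) = f (sym_lin s).
Proof.
pose P (s : S) :=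
  (sym_map f s)@_0 = s@_0 /\ sym_lin (sym_map f s) = f (sym_lin s).
suff: P s by case.
have P1 : P 1 by rewrite /P rmorph1 sym_lin_1 linear0.
have PM u t : P u -> P t -> P (u * t).
  move=> [u0 u1] [t0 t1]; rewrite /P !rmorphM /= u0 t0; split=> //.
  by rewrite !sym_linM u0 u1 t0 t1 linearD !linearZ.
have PX m : P 'X_[m].
  rewrite mpolyXE_id; apply: (big_ind P) => // i _.
  elim: (m i) => [|d IH]; first by rewrite expr0.
  rewrite exprS; apply: PM => //; rewrite -sym_inX /P sym_map_in.
  by rewrite !sym_in0 !sym_lin_in.
rewrite [s]mpolyE; apply: (big_ind P) => [|u t [u0 u1] [t0 t1]|m _].
- by rewrite /P linear0 mcoeff0 (linear_fun0 sym_lin_linear) linear0.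
- rewrite /P linearD !mcoeffD u0 t0; split=> //.
  have [D _] := linearDB sym_lin_linear.
  by rewrite !D linearD u1 t1.
have [m0 m1] := PX m; rewrite /P linearZ /= !mcoeffZ m0; split=> //.
by rewrite !(linear_funZ _ _ sym_lin_linear) linearZ m1.
Qed.

Lemma mderiv_sym_in (i : 'I_n) (v : V) :
  mderiv i (sym_in v) = (coord e i v)%:MP.
Proof.
rewrite /sym_in raddf_sum (bigD1 i) //= mderivZ mderivX mnm1E eqxx scale1r.
rewrite -[X in (X - _)%MM]add0m addmK mpolyX0 -mul_mpolyC mulr1.
rewrite big1 ?addr0 // => j ji.
by rewrite mderivZ mderivX mnm1E (negPf ji) scale0r scaler0.
Qed.

(** The symmetrization of a bilinear map factors through the product of S; the
    factorization Q contracts F with the second derivatives at the origin. *)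
Lemma sym_polarization (W : lmodType k) (F : V -> V -> W) :
  (forall x, linear (F x)) -> (forall y, linear (F^~ y)) ->
  exists Q : S -> W, [/\ linear Q, forall x, Q (sym_in x) = 0 &
    forall x y, Q (sym_in x * sym_in y) = F x y + F y x].
Proof.
move=> lr ll.
exists (fun s => \sum_(i < n) \sum_(j < n)
  (mderiv j (mderiv i s))@_0 *: F e`_i e`_j); split.
- move=> a s t; rewrite scaler_sumr -big_split; apply: eq_bigr => i _ /=.
  rewrite scaler_sumr -big_split; apply: eq_bigr => j _ /=.
  by rewrite !mderivD !mderivZ mcoeffD mcoeffZ scalerDl scalerA.
- move=> x; rewrite big1 // => i _; rewrite big1 // => j _.
  by rewrite mderiv_sym_in mderivC mcoeff0 scale0r.
have FE x y : F x y = \sum_(i < n) \sum_(j < n)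
    (coord e i x * coord e j y) *: F e`_i e`_j.
  rewrite {1}(coord_vbasis (memvf x)) (linear_fun_sum _ _ _ (ll y)).
  apply: eq_bigr => i _; rewrite (linear_funZ _ _ (ll y)).
  rewrite {1}(coord_vbasis (memvf y)) (linear_fun_sum _ _ _ (lr _)) scaler_sumr.
  by apply: eq_bigr => j _; rewrite (linear_funZ _ _ (lr _)) scalerA.
move=> x y; rewrite (FE x y) (FE y x) -big_split; apply: eq_bigr => i _ /=.
rewrite -big_split; apply: eq_bigr => j _ /=; rewrite -scalerDl; congr (_ *: _).
rewrite mderivM mderivD !mderivM !mderiv_sym_in !mderivC mul0r mulr0 add0r addr0.
by rewrite mcoeffD !rmorphM /= !mcoeffC eqxx !mulr1 [coord e j x * _]mulrC.
Qed.

End SymmetricAlgebraFacts.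

(** * The skew group algebra and Koszul cochains *)

Section SkewGroupAlgebra.
Variables (k : fieldType) (gT : finGroupType) (V : vectType k).
Variable rho : linear_rep gT V.
Local Notation SG := (skew_galg rho).
Local Notation inV := (skew_in rho).
Local Notation elt := (skew_elt rho).
Local Notation grp := (skew_elt rho 1).

Lemma rep_mulE g h v : rho (g * h)%g v = rho g (rho h v).
Proof. by rewrite rep_mul lfunE. Qed.

Lemma rep_VK g v : rho g^-1%g (rho g v) = v.
Proof. by rewrite -rep_mulE mulVg rep_one lfunE. Qed.

Lemma skew_eltM s g t h :
  elt s g * elt t h = elt (s * sym_map (rho g) t) (g * h)%g.
Proof. exact: skew_mul_elt. Qed.

Lemma skew_elt_linear g : linear (elt^~ g).
Proof.
move=> a x y; apply/ffunP => h; rewrite !ffunE.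
by case: ifP => // _; rewrite scaler0 addr0.
Qed.

Lemma skew_in_linear : linear inV.
Proof. by move=> a x y; rewrite /skew_in linearP skew_elt_linear. Qed.

Lemma skew_inC v w : inV v * inV w = inV w * inV v.
Proof. by rewrite /skew_in !skew_eltM !rep_one !sym_map1 mulrC. Qed.

Lemma grp1 : grp 1%g = 1. Proof. by []. Qed.

Lemma grpM g h : grp (g * h)%g = grp g * grp h.
Proof. by rewrite skew_eltM rmorph1 mulr1. Qed.

Lemma grpKV g : grp g * grp g^-1%g = 1.
Proof. by rewrite -grpM mulgV. Qed.

Lemma grpVK g : grp g^-1%g * grp g = 1.
Proof. by rewrite -grpM mulVg. Qed.

Lemma skew_eltE s g : elt s g = elt s 1%g * grp g.
Proof. by rewrite skew_eltM rmorph1 mulr1 mul1g. Qed.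

Lemma grp_in g v : grp g * inV v = inV (rho g v) * grp g.
Proof.
by rewrite !skew_eltM rmorph1 mulr1 mul1r mulg1 mul1g sym_map_in.
Qed.

Lemma in_conj g v : grp g * inV v * grp g^-1%g = inV (rho g v).
Proof. by rewrite grp_in -mulrA grpKV mulr1. Qed.

Lemma skew_sum (x : SG) : x = \sum_(g : gT) elt (x g) g.
Proof.
apply/ffunP => h; rewrite sum_ffunE (bigD1 h) //= ffunE eqxx big1 ?addr0 //.
by move=> g /negPf gh; rewrite ffunE eq_sym gh.
Qed.

Lemma skew_mul_grp (x : SG) h : x * grp h = \sum_(g : gT) elt (x (g * h^-1)%g) g.
Proof.
rewrite {1}[x]skew_sum mulr_suml (reindex_inj (mulIg h^-1%g)) /=.
by apply: eq_bigr => g _; rewrite skew_eltM rmorph1 mulr1 mulgKV.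
Qed.

Lemma skew_actE h (x : SG) : skew_act h x = grp h * x * grp h^-1%g.
Proof.
apply/ffunP => y; transitivity (\sum_(g : gT) skew_act h (elt (x g) g) y).
  rewrite ffunE {1}[x]skew_sum sum_ffunE linear_sum.
  by apply: eq_bigr => g _; rewrite [in RHS]ffunE.
rewrite [in RHS](skew_sum x) mulr_sumr mulr_suml sum_ffunE.
by apply: eq_bigr => g _; rewrite skew_act_elt !skew_eltM rmorph1 mulr1 mul1r.
Qed.

Lemma skew_in_mul v (x : SG) h : (inV v * x) h = sym_in v * x h.
Proof.
rewrite [_ * x]/(skew_mul _ _) ffunE (bigD1 1%g) //= big1 ?addr0.
  by rewrite ffunE eqxx rep_one sym_map1 invg1 mul1g.
by move=> g /negPf g1; rewrite ffunE g1 mul0r.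
Qed.

Lemma skew_mul_in v (x : SG) h : (x * inV v) h = x h * sym_in (rho h v).
Proof.
rewrite [x * _]/(skew_mul _ _) ffunE (bigD1 h) //= big1 ?addr0.
  by rewrite ffunE mulVg eqxx sym_map_in.
by move=> g gh; rewrite ffunE -eq_mulVg1 (negPf gh) linear0 mulr0.
Qed.

Lemma skew_addE (x y : SG) h : (x + y) h = x h + y h.
Proof. by rewrite ffunE. Qed.

Lemma skew_subE (x y : SG) h : (x - y) h = x h - y h.
Proof. by rewrite !ffunE. Qed.

Lemma koszul_restrict_hdiff p (f : ('I_p -> SG) -> SG) (v : 'I_p.+1 -> V) :
  koszul_restrict (hdiff f) v = kdiff (koszul_restrict f) v.
Proof.
apply: (antisymmetrized_hdiff f (x := fun i => inV (v i))) => i j.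
exact: skew_inC.
Qed.

Lemma koszul_restrict_kcochain p (f : ('I_p -> SG) -> SG) :
  multilinear f -> kcochain (koszul_restrict f).
Proof.
move=> lf; split=> [i u a x y | v i j neq_ij Ev].
  rewrite /koszul_restrict scaler_sumr -big_split; apply: eq_bigr => s _ /=.
  have E w : (fun j : 'I_p => inV ([eta u with i |-> w] (s j))) =
     [eta (fun j => inV (u (s j))) with s^-1%g i |-> inV w].
    apply/funext => j /=; rewrite -(inj_eq (@perm_inj _ s)) permKV.
    by case: ifP.
  by rewrite !E skew_in_linear lf mulrDr scalerAr.
apply: (@signed_sum_eq0 _ _ (fun s => s * tperm i j)%g).
- exact: mulIg.
- by move=> s; rewrite odd_permM odd_tperm neq_ij addbT.
move=> s; congr f; apply/funext => l; rewrite permM; congr inV.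
by case: tpermP => [->|->|].
Qed.

Lemma koszul_restrict2 (f : ('I_2 -> SG) -> SG) v w :
  koszul_restrict f (pair2 v w) =
  f (pair2 (inV v) (inV w)) - f (pair2 (inV w) (inV v)).
Proof.
rewrite /koszul_restrict.
transitivity (\sum_(s : 'S_2) (-1) ^+ s * f (pair2 (inV (pair2 v w (s 0)))
   (inV (pair2 v w (s 1))))).
  apply: eq_bigr => s _; congr (_ * f _).
  by rewrite [LHS]pair2E.
rewrite (sum_S2 (fun b i j =>
  (-1) ^+ b * f (pair2 (inV (pair2 v w i)) (inV (pair2 v w j))))).
by rewrite /= mul1r mulN1r.
Qed.

Definition kdiff1 (d : V -> SG) v w :=
  commr (inV v) (d w) - commr (inV w) (d v).

Lemma kdiff1E (d : ('I_1 -> V) -> SG) v w :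
  kdiff d (pair2 v w) = kdiff1 (fun x => d (fun=> x)) v w.
Proof.
rewrite /kdiff (alternating_sum2 (fun i => inV (pair2 v w i) *
  d (fun j => pair2 v w (lift i j)) - d (fun j => pair2 v w (lift i j)) *
  inV (pair2 v w i))).
have E0 : (fun j => pair2 v w (lift 0 j)) = (fun=> w).
  by apply/funext => j; rewrite /pair2 (tnth_nth v) ord1.
have E1 : (fun j => pair2 v w (lift 1 j)) = (fun=> v).
  by apply/funext => j; rewrite /pair2 (tnth_nth v) ord1.
by rewrite E0 E1.
Qed.

Lemma kdiff1_conj (d : V -> SG) (h : gT) v w :
  kdiff1 (fun u => grp h^-1%g * d (rho h u) * grp h) v w =
  grp h^-1%g * kdiff1 d (rho h v) (rho h w) * grp h.
Proof.
have C u x : commr (inV u) (grp h^-1%g * x * grp h) =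
    grp h^-1%g * commr (inV (rho h u)) x * grp h.
  rewrite -(commrJ _ _ (grpKV h)); congr (commr _ _).
  by have := in_conj h^-1%g (rho h u); rewrite rep_VK invgK.
by rewrite /kdiff1 !C conjrB.
Qed.

Lemma kinvariant_conj (alpha : ('I_2 -> V) -> SG) : kinvariant alpha ->
  forall h v w, alpha (pair2 (rho h v) (rho h w)) =
    grp h * alpha (pair2 v w) * grp h^-1%g.
Proof.
move=> inv h v w; rewrite -skew_actE -[LHS](inv h).
by rewrite (fun_pair2 (rho h^-1%g)) !rep_VK.
Qed.

Lemma degree_le1E p (beta : ('I_p -> V) -> SG) : kdegree_le1 beta ->
  forall v h, beta v h = (beta v h)@_0 *: 1 + sym_in (sym_lin (beta v h)).
Proof.
move=> [b0 [b1 [[_ c0] [_ l1] E]]] v h.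
have [D _] := linearDB (@sym_lin_linear k V).
rewrite E ffunE D (sym_linC (c0 v h)) add0r -(homog1_sym_in (l1 v h)).
congr (_ + _); rewrite mcoeffD {1}(homog0_const (c0 v h)).
by rewrite (homog1_sym_in (l1 v h)) sym_in0 addr0.
Qed.

(** The g-component takes values in S(V^g), on which g acts trivially. *)
Lemma in_H_fixed p (alpha : ('I_p -> V) -> SG) : in_H alpha ->
  forall v g, rho g (sym_lin (alpha v g)) = sym_lin (alpha v g).
Proof.
move=> Ha v g; rewrite -sym_lin_map; congr sym_lin.
have [r [s [xi [Hgen ->]]]] := Ha g; rewrite linear_sum; apply: eq_bigr => l _.
rewrite linearZ /=; congr (_ *: _).
have [_ [q ->] _ _] := Hgen l.
rewrite comp_mpolyE linear_sum; apply: eq_bigr => mn _.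
rewrite linearZ rmorph_prod /=; congr (_ *: _); apply: eq_bigr => i _.
rewrite rmorphXn /= tnth_mktuple sym_map_in; congr (sym_in _ ^+ _).
by apply/fixedSpaceP/vbasis_mem/mem_nth; rewrite size_tuple.
Qed.

Definition cyclic_triples (v : 'I_3 -> V) : seq (V * V * V) :=
  [:: (v 0, v 1, v 2); (v 1, v 2, v 0); (v 2, v 0, v 1)].

Lemma kcocycle_component (beta : ('I_2 -> V) -> SG) v h :
  kcochain beta -> kdiff beta v = 0 ->
  \sum_(p <- cyclic_triples v)
    beta (pair2 p.1.1 p.1.2) h * sym_in (rho h p.2 - p.2) = 0.
Proof.
move=> [lb ab] db.
pose T x y z := beta (pair2 x y) h * sym_in (rho h z - z).
have bN x y : beta (pair2 x y) = - beta (pair2 y x).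
  have b0 z : beta (pair2 z z) = 0 by exact: (ab _ 0 1).
  apply/eqP; rewrite -addr_eq0 -(b0 (x + y)) (pair2Dl lb) !(pair2Dr lb).
  by rewrite !b0 add0r addr0.
pose C x y z := inV z * beta (pair2 x y) - beta (pair2 x y) * inV z.
have TE x y z : C x y z h = - T x y z.
  rewrite /C skew_subE skew_in_mul skew_mul_in /T linearB mulrBr opprB.
  by rewrite mulrC.
have L (i : 'I_3) (x y : V) : v (lift i 0) = x -> v (lift i 1) = y ->
    (fun j : 'I_2 => v (lift i j)) = pair2 x y.
  by move=> <- <-; rewrite [LHS]pair2E.
have dbE : kdiff beta v =
    C (v 1) (v 2) (v 0) + C (v 2) (v 0) (v 1) + C (v 0) (v 1) (v 2).
  rewrite /kdiff (alternating_sum3 (fun i =>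
    inV (v i) * beta (fun j => v (lift i j))
    - beta (fun j => v (lift i j)) * inV (v i))).
  rewrite (L 0 (v 1) (v 2)) ?(L 1 (v 0) (v 2)) ?(L 2 (v 0) (v 1)) //;
    try by congr v; exact: val_inj.
  by rewrite (bN (v 0) (v 2)) mulrN mulNr -opprD opprK.
have : kdiff beta v h = 0 by rewrite db ffunE.
(* With its body hidden, C h is not itself mistaken for a value of a sum. *)
rewrite dbE; clearbody C; rewrite 2!skew_addE 3!TE !big_cons big_nil addr0.
exact: sum3_opp_eq0.
Qed.

Lemma half_bracketE (alpha beta : ('I_2 -> V) -> SG) v :
  half_bracket alpha beta v = \sum_(p <- cyclic_triples v) \sum_(h : gT)
    alpha (pair2 (sym_lin (beta (pair2 p.1.1 p.1.2) h)) p.2) * grp h.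
Proof.
pose T x y z :=
  \sum_(h : gT) alpha (pair2 (sym_lin (beta (pair2 x y) h)) z) * grp h.
transitivity (\sum_(s in ('Alt_('I_3))%g) T (v (s 0)) (v (s 1)) (v (s 2))).
  rewrite /half_bracket exchange_big /=.
  under eq_bigr => h _ do rewrite exchange_big.
  rewrite exchange_big /=; apply: eq_bigr => s _; apply: eq_bigr => h _.
  by rewrite skew_mul_grp.
rewrite (sum_Alt3 (fun i j l => T (v i) (v j) (v l))).
by rewrite !big_cons big_nil addr0 /= addrA.
Qed.

End SkewGroupAlgebra.

(** * Bar cocycles restricting exactly to a given Koszul cocycle *)

Section ExactRepresentatives.
Variables (k : fieldType) (gT : finGroupType) (V : vectType k).
Variable rho : linear_rep gT V.
Hypothesis card_neq0 : (#|gT|%:R : k) != 0.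
Local Notation SG := (skew_galg rho).
Local Notation inV := (skew_in rho).
Local Notation elt := (skew_elt rho).
Local Notation grp := (skew_elt rho 1).

Lemma equivariant_primitive (d : V -> SG) : linear d ->
  (forall h v w,
    kdiff1 d (rho h v) (rho h w) = grp h * kdiff1 d v w * grp h^-1%g) ->
  exists d' : V -> SG, [/\ linear d',
    forall h v, d' (rho h v) = grp h * d' v * grp h^-1%g &
    forall v w, kdiff1 d' v w = kdiff1 d v w].
Proof.
move=> ld dinv.
pose d' v := (#|gT|%:R : k)^-1 *:
  \sum_(h : gT) grp h^-1%g * d (rho h v) * grp h.
exists d'; split.
- apply: linear_scaled_sum => h a x y.
  by rewrite linearP ld mulrDr mulrDl -scalerAr -scalerAl.
- move=> h v; rewrite /d' -scalerAr -scalerAl mulr_sumr mulr_suml.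
  congr (_ *: _); rewrite [RHS](reindex_inj (mulIg h)) /=.
  apply: eq_bigr => g _.
  by rewrite invMg !grpM rep_mulE !mulrA grpKV mul1r -!mulrA grpKV mulr1.
move=> v w; transitivity ((#|gT|%:R : k)^-1 *: \sum_(h : gT)
    kdiff1 (fun u => grp h^-1%g * d (rho h u) * grp h) v w).
  have C x (F : gT -> SG) c : commr x (c *: \sum_(h : gT) F h) =
      c *: \sum_(h : gT) commr x (F h).
    exact: commr_scaled_sum.
  by rewrite /kdiff1 /d' !C -scalerBr -sumrB.
rewrite -[RHS](average_const card_neq0); congr (_ *: _); apply: eq_bigr => h _.
by rewrite kdiff1_conj dinv conjrKV // grpVK.
Qed.

(** The correction D extends an equivariant primitive d' from V to S # G by
    s g |-> d'(linear part of s) g, which commutes with both multiplications by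
    G and vanishes on G; hence subtracting its differential preserves
    normalization. *)
Lemma exact_representative (m : hcocycle SG 2) (alpha : ('I_2 -> V) -> SG) :
  kinvariant alpha -> kcoboundary (fun v => koszul_restrict m v - alpha v) ->
  exists m' : hcocycle SG 2, [/\ \pi_(HH SG 2)%qT m' = \pi_(HH SG 2)%qT m,
    normalized (skew_elt rho 1) m' &
    forall v w, m' (pair2 (inV v) (inV w)) - m' (pair2 (inV w) (inV v)) =
      alpha (pair2 v w)].
Proof.
move=> inva [delta [ldelta _] mdelta].
have [m1 Em1 m1n] :=
  cohomologous_to_normalized (grp1 rho) (grpM rho) card_neq0 m.
have /eqquotP /asboolP [g lg m1g] := Em1.
pose d v := delta (fun=> v) + g (fun=> inV v).
have ld : linear d.
  move=> a x y; rewrite /d (linear_of_fun1 ldelta) skew_in_linear.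
  by rewrite (linear_of_fun1 lg) scalerDr addrACA.
have m1d v w : m1 (pair2 (inV v) (inV w)) - m1 (pair2 (inV w) (inV v)) =
    alpha (pair2 v w) + kdiff1 d v w.
  have Em x y : m (pair2 x y) = m1 (pair2 x y) - hdiff g (pair2 x y).
    by rewrite -m1g subKr.
  have := mdelta (pair2 v w); rewrite koszul_restrict2 kdiff1E !Em !hdiff1E.
  rewrite (@skew_inC _ _ _ rho w v) => /diff_eq_of_corrected ->.
  rewrite antisymmetrized_hdiff1; congr (_ + _).
  exact/esym/commr_sub_add.
have m1J h v w : m1 (pair2 (inV (rho h v)) (inV (rho h w))) =
    grp h * m1 (pair2 (inV v) (inV w)) * grp h^-1%g.
  rewrite -(normalizedMl m1n) -(normalizedMr m1n) grp_in.
  by rewrite (normalized_balanced m1n) mulrA in_conj.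
have dinv h v w : kdiff1 d (rho h v) (rho h w) =
    grp h * kdiff1 d v w * grp h^-1%g.
  have E x y : kdiff1 d x y = m1 (pair2 (inV x) (inV y))
      - m1 (pair2 (inV y) (inV x)) - alpha (pair2 x y).
    by rewrite m1d addrC addKr.
  by rewrite !E !m1J (kinvariant_conj inva) !conjrB.
have [d' [ld' d'J d'K]] := equivariant_primitive ld dinv.
pose D (x : SG) := \sum_(g : gT) d' (sym_lin (x g)) * grp g.
have lD : linear D.
  move=> a x y; rewrite scaler_sumr -big_split; apply: eq_bigr => h _ /=.
  by rewrite !ffunE sym_lin_linear ld' mulrDl scalerAl.
have d'0 : d' 0 = 0 := linear_fun0 ld'.
have D_elt s h : D (elt s h) = d' (sym_lin s) * grp h.
  rewrite /D (bigD1 h) //= ffunE eqxx big1 ?addr0 // => h' /negPf h'h.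
  by rewrite ffunE h'h (linear_fun0 (@sym_lin_linear _ _)) d'0 mul0r.
have D_sum (x : SG) : D x = \sum_(h : gT) D (elt (x h) h).
  by rewrite {1}[x]skew_sum (linear_fun_sum _ _ _ lD).
have DMl h x : D (grp h * x) = grp h * D x.
  rewrite [in LHS](skew_sum x) mulr_sumr (linear_fun_sum _ _ _ lD).
  rewrite D_sum mulr_sumr; apply: eq_bigr => h' _.
  rewrite skew_eltM mul1r !D_elt sym_lin_map d'J grpM.
  by rewrite !mulrA -[_ * grp h^-1%g * _]mulrA grpVK mulr1.
have DMr h x : D (x * grp h) = D x * grp h.
  rewrite [in LHS](skew_sum x) mulr_suml (linear_fun_sum _ _ _ lD).
  rewrite D_sum mulr_suml; apply: eq_bigr => h' _.
  by rewrite skew_eltM rmorph1 mulr1 !D_elt grpM !mulrA.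
have D_grp h : D (grp h) = 0 by rewrite D_elt sym_lin_1 d'0 mul0r.
have D_in v : D (inV v) = d' v by rewrite D_elt sym_lin_in grp1 mulr1.
have [m' Em' m'E] := cohomologous_sub m1 lD; exists m'; split.
- by rewrite Em'.
- move=> h x; rewrite !m'E (proj1 (m1n h x)) (proj2 (m1n h x)) DMl DMr D_grp.
  split; first by rewrite mul0r subrr addr0 subrr.
  by rewrite mulr0 subrK subrr.
move=> v w; rewrite !m'E (@skew_inC _ _ _ rho w v).
apply: corrected_diff_eq (m1d v w) _.
by rewrite antisymmetrized_hdiff1 !D_in -d'K.
Qed.

End ExactRepresentatives.

(** * The bracket of exact representatives *)

Section BracketOfRepresentatives.
Variables (k : fieldType) (gT : finGroupType) (V : vectType k).
Variable rho : linear_rep gT V.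
Hypothesis card_neq0 : (#|gT|%:R : k) != 0.
Local Notation SG := (skew_galg rho).
Local Notation inV := (skew_in rho).
Local Notation elt := (skew_elt rho).
Local Notation grp := (skew_elt rho 1).

(** N is |G| times the projection of V onto V^g that kills (g - 1)V, which
    separates the two factors: the symmetrization of the bilinear map
    (x, y) |-> F(N x, |G| y - N y) is a multiple of F on pairs formed of a fixed
    vector and an element of (g - 1)V, and it factors through the product of S
    by [sym_polarization]. *)
Lemma sum_fixed_moved_eq0 (W : lmodType k) (F : V -> V -> W) (g : gT)
    (I : Type) (r : seq I) (c : I -> k) (b w : I -> V) :
  (forall x, linear (F x)) -> (forall y, linear (F^~ y)) ->
  (forall i, rho g (b i) = b i) ->
  \sum_(i <- r) (c i *: 1 + sym_in (b i)) * sym_in (rho g (w i) - w i) = 0 ->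
  \sum_(i <- r) F (b i) (rho g (w i) - w i) = 0.
Proof.
move=> lr ll bfix E.
pose n := #|gT|; pose N x := \sum_(j < n) rho (g ^+ j)%g x.
have lN : linear N.
  move=> a x y; rewrite scaler_sumr -big_split; apply: eq_bigr => j _ /=.
  by rewrite linearP.
have Nb i : N (b i) = n%:R *: b i.
  rewrite scaler_nat -[in RHS](card_ord n) -sumr_const; apply: eq_bigr => j _.
  elim: (j : nat) => [|l IH]; first by rewrite rep_one lfunE.
  by rewrite expgSr rep_mulE bfix.
have Nw x : N (rho g x - x) = 0.
  have [_ ->] := linearDB lN; rewrite -sumrB.
  pose t j := rho (g ^+ j)%g x.
  rewrite (eq_bigr (fun j : 'I_n => t j.+1 - t j)).
    rewrite -(big_mkord xpredT (fun j => t j.+1 - t j)) telescope_sumr //.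
    by rewrite /t /n -cardsT expg_cardG ?inE // expg0 subrr.
  by move=> j _; rewrite /t expgSr rep_mulE.
pose F' x y := F (N x) (n%:R *: y - N y).
have lr' x : linear (F' x).
  move=> a y z; rewrite /F' -lr; congr (F _ _).
  by rewrite lN scalerDr scalerBr !scalerA [a * _]mulrC opprD addrACA -!scalerA.
have ll' y : linear (F'^~ y) by move=> a x z; rewrite /F' lN ll.
have [Q [lQ Q1 Q2]] := sym_polarization lr' ll'.
have /(congr1 Q) := E; rewrite (linear_fun0 lQ) (linear_fun_sum _ _ _ lQ).
have [QD _] := linearDB lQ.
have n0 : n%:R != 0 :> k := card_neq0.
have Fx0 y : F 0 y = 0 := linear_fun0 (ll y).
have E' i : Q ((c i *: 1 + sym_in (b i)) * sym_in (rho g (w i) - w i)) =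
    (n%:R * n%:R) *: F (b i) (rho g (w i) - w i).
  rewrite mulrDl QD -scalerAl mul1r (linear_funZ _ _ lQ) Q1 scaler0 add0r Q2.
  rewrite /F' Nw Fx0 addr0 subr0 Nb.
  by rewrite (linear_funZ _ _ (lr _)) (linear_funZ _ _ (ll _)) scalerA.
under eq_bigr => i _ do rewrite E'.
move=> /eqP; rewrite -scaler_sumr scaler_eq0 mulf_eq0 (negPf n0) /=.
by move/eqP.
Qed.

Section HalfBracket.
Variables (m : hcocycle SG 2) (alpha beta : ('I_2 -> V) -> SG).
Hypothesis m0 : normalized (skew_elt rho 1) m.
Hypothesis m_alpha : forall v w,
  m (pair2 (inV v) (inV w)) - m (pair2 (inV w) (inV v)) = alpha (pair2 v w).

Let lm := hcocycle_multilinear m.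

(** Moving h from the first argument to the right turns z into hz; comparing
    hz with z leaves alpha and the second summand. *)
Lemma commutator_component c b h z :
  let x := elt (c *: 1 + sym_in b) h in
  m (pair2 x (inV z)) - m (pair2 (inV z) x) =
  alpha (pair2 b z) * grp h + m (pair2 (inV b) (inV (rho h z - z))) * grp h.
Proof.
move=> x.
have -> : x = (c *: 1 + inV b) * grp h.
  rewrite /x skew_eltE; congr (_ * _); rewrite /skew_in -grp1.
  by rewrite (skew_elt_linear rho 1%g c 1 (sym_in b)).
have m1 y : m (pair2 1 y) = 0 /\ m (pair2 y 1) = 0 by exact: (m0 1%g y).
rewrite (normalized_balanced m0 h _ (inV z)) (normalizedMr m0 h (inV z)).
rewrite grp_in (normalizedMr m0 h _ (inV (rho h z))).
rewrite (pair2_linl lm) (pair2_linr lm) !(proj1 (m1 _)) !(proj2 (m1 _)).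
rewrite scaler0 !add0r -mulrBl -mulrDl; congr (_ * _).
have [_ inB] := linearDB (skew_in_linear rho).
rewrite -m_alpha inB (pair2Br lm).
by rewrite [RHS]addrC subrKA.
Qed.

Hypothesis beta_degree : kdegree_le1 beta.
Hypothesis beta_fixed : forall v h,
  rho h (sym_lin (beta v h)) = sym_lin (beta v h).

Lemma sum_commutators v : kcochain beta -> kdiff beta v = 0 ->
  \sum_(p <- cyclic_triples v)
    (m (pair2 (beta (pair2 p.1.1 p.1.2)) (inV p.2))
     - m (pair2 (inV p.2) (beta (pair2 p.1.1 p.1.2)))) =
  half_bracket alpha beta v.
Proof.
move=> cb db; rewrite half_bracketE.
have beta1 := degree_le1E beta_degree.
pose b h (p : V * V * V) := sym_lin (beta (pair2 p.1.1 p.1.2) h).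
pose F h x y := m (pair2 (inV x) (inV y)) * grp h.
have E p : m (pair2 (beta (pair2 p.1.1 p.1.2)) (inV p.2))
     - m (pair2 (inV p.2) (beta (pair2 p.1.1 p.1.2))) =
  \sum_(h : gT) alpha (pair2 (b h p) p.2) * grp h
  + \sum_(h : gT) F h (b h p) (rho h p.2 - p.2).
  rewrite -big_split [beta _]skew_sum (linear_fun_sum _ _ _ (pair2_linl lm _)).
  rewrite (linear_fun_sum _ _ _ (pair2_linr lm _)) -sumrB.
  by apply: eq_bigr => h _; rewrite beta1 commutator_component.
rewrite (eq_bigr _ (fun p _ => E p)) big_split /=.
rewrite [X in _ + X](_ : _ = 0) ?addr0 // exchange_big big1 //= => h _.
apply: (sum_fixed_moved_eq0
  (c := fun p => (beta (pair2 p.1.1 p.1.2) h)@_0)).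
- move=> x a y z; rewrite /F skew_in_linear (pair2_linr lm) mulrDl.
  by rewrite scalerAl.
- move=> y a x z; rewrite /F skew_in_linear (pair2_linl lm) mulrDl.
  by rewrite scalerAl.
- by move=> p; exact: beta_fixed.
rewrite -[RHS](kcocycle_component h cb db); apply: eq_bigr => p _.
by rewrite -beta1.
Qed.

End HalfBracket.

Lemma koszul_restrict_hcirc (m n : hcocycle SG 2)
    (alpha beta : ('I_2 -> V) -> SG) v :
  normalized (skew_elt rho 1) m ->
  (forall v w,
    m (pair2 (inV v) (inV w)) - m (pair2 (inV w) (inV v)) = alpha (pair2 v w)) ->
  (forall v w,
    n (pair2 (inV v) (inV w)) - n (pair2 (inV w) (inV v)) = beta (pair2 v w)) ->
  in_H beta -> kdegree_le1 beta -> kcochain beta -> kdiff beta v = 0 ->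
  koszul_restrict (hcirc m n) v = half_bracket alpha beta v.
Proof.
move=> m0 ma nb Hb db cb cyb.
rewrite -(sum_commutators m0 ma db (in_H_fixed Hb) cb cyb).
rewrite !big_cons big_nil addr0 /= -!nb addrA.
exact: (antisymmetrized_hcirc n (fun i => inV (v i)) (hcocycle_multilinear m)).
Qed.

End BracketOfRepresentatives.

Theorem theorem6p3 (k : fieldType) (gT : finGroupType) (V : vectType k)
    (rho : linear_rep gT V)
    (char_k : 2%N \notin [pchar k])
    (card_G : (#|gT|%:R : k) != 0)
    (eigen_k : eigenvalues_in_field rho)
    (a b : HH (skew_galg rho) 2)
    (alpha beta : ('I_2 -> V) -> skew_galg rho)
    (H_alpha : in_H alpha) (inv_alpha : kinvariant alpha)
    (deg_alpha : kdegree_le1 alpha)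
    (H_beta : in_H beta) (inv_beta : kinvariant beta)
    (deg_beta : kdegree_le1 beta)
    (rep_alpha : represents alpha a) (rep_beta : represents beta b) :
  represents (cochain_bracket alpha beta) (gbracket a b).
Proof.
have [ca za [m0 m0a m0alpha]] := rep_alpha.
have [cb zb [n0 n0b n0beta]] := rep_beta.
have [m [mE m1 malpha]] := exact_representative card_G inv_alpha m0alpha.
have [n [nE n1 nbeta]] := exact_representative card_G inv_beta n0beta.
have restrE : cochain_bracket alpha beta = koszul_restrict (gbracket_cocycle m n).
  apply/funext => v; rewrite /cochain_bracket.
  rewrite -(koszul_restrict_hcirc card_G m1 malpha nbeta) //.
  rewrite -(koszul_restrict_hcirc card_G n1 nbeta malpha) //.
  rewrite /koszul_restrict -big_split; apply: eq_bigr => s _.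
  exact/esym/mulrDr.
split.
- by rewrite restrE; exact/koszul_restrict_kcochain/hcocycle_multilinear.
- move=> v; rewrite restrE -koszul_restrict_hdiff.
  rewrite /koszul_restrict big1 // => s _.
  by rewrite hcocycle_closed mulr0.
exists (gbracket_cocycle m n); first by rewrite -gbracket_pi mE nE m0a n0b.
exists (fun=> 0); first by split=> [|//]; exact: multilinear0.
move=> v; rewrite restrE subrr /kdiff big1 // => i _.
by rewrite mulr0 mul0r subrr mulr0.
Qed.
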